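(* Let $G=(V,E)$ be a connected loopless multigraph whose vertex set is partitioned into non-empty subsets $V_0,V_1,\dots,V_k$ ($k\ge 1$) such that: (i) $V_i$ is a clique of $G$ for all $i=1,\dots,k$; (ii) $E_G(V_i,V_j)=\emptyset$ for all $1\le i<j\le k$; (iii) putting $M_i=E_G(V_i,V_0)$ for $1\le i\le k$ and $M=M_1\cup\cdots\cup M_k$, each component of $G[M]$ is a star with a center in $V_0$. Let $U=V_1\cup\cdots\cup V_k$, and for $1\le i\le k$ let $v_i$ be the vertex of $G\bullet U$ obtained by contracting $V_i$. Then for any $N\subseteq E(G[V_0])$, $$\tau_G(M\cup N)=\prod_{i=1}^k |V_i|^{|V_i|-2-|M_i|}\sum_{T\in \mathcal{ST}_{G\bullet U}(N)}\ \prod_{i=1}^k |V_i|^{|E_T(v_i)|}.$$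
   Context: Graphs are finite multigraphs without loops (parallel edges allowed). A set $X$ of vertices is a clique of $G$ if $G[X]$ is a complete graph; in particular $G[X]$ has no parallel edges. $E_G(X,Y)$ is the set of edges of $G$ with one end in $X$ and the other in $Y$. For a set of edges $M$, $G[M]$ is the subgraph consisting of the edges in $M$ and their end-vertices. Condition (iii) is equivalent to: each vertex in $V_1\cup\cdots\cup V_k$ is incident with at most one edge of $M$. $\mathcal{ST}_G(W)$ is the set of spanning trees $T$ of $G$ with $W\subseteq E(T)$, and $\tau_G(W)=|\mathcal{ST}_G(W)|$ (parallel edges are distinct, so spanning trees are distinguished by their edge sets). $G\bullet U$ is the graph obtained from $G$ by contracting all edges of $G[U]$; here it has vertex set $V_0\cup\{v_1,\dots,v_k\}$, where all vertices of $V_i$ are identified to $v_i$, and its edge set is identified with $M\cup E(G[V_0])$ (parallel edges are kept). $E_T(v)$ is the set of edges of $T$ incident with $v$. *)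

(* Defs.v *)
From mathcomp Require Import all_boot.

Set Implicit Arguments.
Unset Strict Implicit.
Unset Printing Implicit Defensive.

(* A finite loopless multigraph whose vertices and edges are taken from ambient
   finite types, so that subgraphs and contractions of G keep the names of the
   edges of G.  [ends] is meaningful on [eset] only.  Looplessness is the
   condition that an edge has exactly two ends. *)
Record mgraph (V E : finType) := MGraph {
  vset : {set V};
  eset : {set E};
  ends : E -> {set V};
  ends_sub : forall e, e \in eset -> ends e \subset vset;
  ends_card : forall e, e \in eset -> #|ends e| = 2
}.

Section Graphs.

Variables V E : finType.
Implicit Types (G H : mgraph V E) (X Y U C : {set V}) (M W T : {set E}).

Definition adjacent G : rel V :=
  fun x y => [exists e in eset G, ends G e == [set x; y]].

Definition connected G : bool :=
  (vset G != set0) && [forall x in vset G, forall y in vset G,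
                         connect (adjacent G) x y].

Lemma adjacentC G : symmetric (adjacent G).
Proof. by move=> x y; rewrite /adjacent setUC. Qed.

Lemma connect_adjacent_equiv G (D : {set V}) :
  {in D & &, equivalence_rel (connect (adjacent G))}.
Proof.
move=> x y z _ _ _; split=> [|xy]; first exact: connect0.
by apply: (same_connect _ xy); apply: sym_connect_sym; exact: adjacentC.
Qed.

(* The vertex sets of the connected components. *)
Definition components G : {set {set V}} :=
  equivalence_partition (connect (adjacent G)) (vset G).

Lemma components_partition G : partition (components G) (vset G).
Proof. exact/equivalence_partitionP/connect_adjacent_equiv. Qed.

(* G[X] *)
Lemma induced_sub G X e :
  e \in [set f in eset G | ends G f \subset X] -> ends G e \subset vset G :&: X.
Proof. by rewrite inE subsetI => /andP[/ends_sub-> ->]. Qed.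

Lemma induced_card G X e :
  e \in [set f in eset G | ends G f \subset X] -> #|ends G e| = 2.
Proof. by rewrite inE => /andP[/ends_card]. Qed.

Definition induced G X : mgraph V E :=
  MGraph (@induced_sub G X) (@induced_card G X).

(* G[M] for a set M of edges *)
Lemma edge_induced_sub G M e :
  e \in eset G :&: M -> ends G e \subset \bigcup_(f in eset G :&: M) ends G f.
Proof. by move=> eM; apply: bigcup_sup. Qed.

Lemma edge_induced_card G M e : e \in eset G :&: M -> #|ends G e| = 2.
Proof. by rewrite inE => /andP[/ends_card]. Qed.

Definition edge_induced G M : mgraph V E :=
  MGraph (@edge_induced_sub G M) (@edge_induced_card G M).

(* The spanning subgraph (V(G), W) *)
Lemma spanning_sub G W e : e \in eset G :&: W -> ends G e \subset vset G.
Proof. by rewrite inE => /andP[/ends_sub]. Qed.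

Definition spanning G W : mgraph V E :=
  MGraph (@spanning_sub G W) (@edge_induced_card G W).

Definition complete G : bool :=
  [forall x in vset G, forall y in vset G,
     (x != y) ==> (#|[set e in eset G | ends G e == [set x; y]]| == 1)].

Definition clique G X : bool := (X \subset vset G) && complete (induced G X).

(* E_G(X,Y) *)
Definition edges_between G X Y : {set E} :=
  [set e in eset G | [exists x in X, exists y in Y, ends G e == [set x; y]]].

Definition star_with_center G (c : V) : bool :=
  [&& c \in vset G,
      [forall e in eset G, c \in ends G e]
    & [forall x in vset G :\ c,
         #|[set e in eset G | ends G e == [set c; x]]| == 1]].

Definition incident G (v : V) : {set E} := [set e in eset G | v \in ends G e].

(* Two parallel edges form a cycle. *)
Definition is_cycle G : bool :=
  connected G && [forall v in vset G, #|incident G v| == 2].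

Definition acyclic G : bool :=
  [forall C : {set E}, (C \subset eset G) ==> ~~ is_cycle (edge_induced G C)].

Definition tree G : bool := connected G && acyclic G.

(* ST_G(W), each spanning tree being given by its edge set *)
Definition spanning_trees G W : {set {set E}} :=
  [set T : {set E} | [&& T \subset eset G, tree (spanning G T) & W \subset T]].

Definition tau G W : nat := #|spanning_trees G W|.

(* The graph obtained from G by contracting all the edges of G[U].  Its
   vertices are the sets of vertices of G which are merged together, that is the
   components of (V(G), E(G[U])); a vertex x outside U becomes [set x]. *)
Definition contract_vset G U : {set {set V}} :=
  components (spanning G (eset (induced G U))).

Definition contract_eset G U : {set E} := eset G :\: eset (induced G U).

Definition contract_ends G U (e : E) : {set {set V}} :=
  pblock (contract_vset G U) @: ends G e.

Lemma contract_vset_partition G U : partition (contract_vset G U) (vset G).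
Proof. exact: components_partition. Qed.

Lemma contract_sub G U e :
  e \in contract_eset G U -> contract_ends G U e \subset contract_vset G U.
Proof.
rewrite inE => /andP[_ eG]; apply/subsetP => _ /imsetP[x xe ->].
apply: pblock_mem; rewrite (cover_partition (contract_vset_partition G U)).
exact: (subsetP (ends_sub eG)).
Qed.

Lemma contract_card G U e :
  e \in contract_eset G U -> #|contract_ends G U e| = 2.
Proof.
rewrite !inE negb_and => /andP[eU eG]; rewrite eG /= in eU.
rewrite card_in_imset ?(ends_card eG) //.
have isol z w : z \notin U ->
    connect (adjacent (spanning G (eset (induced G U)))) z w -> z = w.
  move=> zU /connectP[[|u p] //= /andP[/existsP[f]]].
  rewrite !inE => /andP[/and3P[_ _ /subsetP fU] /eqP fe] _ _.
  by case/negP: zU; apply: fU; rewrite fe !inE eqxx.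
have csym : connect_sym (adjacent (spanning G (eset (induced G U)))).
  exact/sym_connect_sym/adjacentC.
move=> x y xe ye /eqP.
have xG := subsetP (ends_sub eG) x xe; have yG := subsetP (ends_sub eG) y ye.
have /and3P[/eqP cov tI _] := contract_vset_partition G U.
rewrite eq_pblock ?cov //.
rewrite /contract_vset /components.
rewrite (pblock_equivalence_partition (@connect_adjacent_equiv _ (vset G))) // => xy.
have [xU|xU] := boolP (x \in U); last exact: isol xU xy.
have [yU|yU] := boolP (y \in U); last by symmetry; apply: isol yU _; rewrite csym.
apply/eqP; apply: contraNT eU => neq_xy.
suff -> : ends G e = [set x; y] by apply/subsetP=> z; rewrite !inE => /pred2P[] ->.
apply/esym/eqP; rewrite eqEcard cards2 neq_xy (ends_card eG) leqnn andbT.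
by apply/subsetP=> z; rewrite !inE => /pred2P[] ->.
Qed.

Definition contract G U : mgraph {set V} E :=
  MGraph (@contract_sub G U) (@contract_card G U).

End Graphs.

(* Main.v *)
Require Import Defs.
From HB Require Import structures.
From mathcomp Require Import all_boot all_order all_algebra.
From mathcomp Require Import zify.

(** The cliques are collapsed one at a time, and each collapse multiplies a
    weighted count of spanning trees by a known factor.

    Take a clique [X] with [n] vertices and let [MX] be the edges that join it
    to the rest.  A spanning tree containing [MX] splits into a set [A] of
    edges of the clique and a set [H] of other edges, with [MX] inside [H].
    For a fixed acyclic [H], whether [A] completes [H] to a spanning tree only
    depends on the partition of the vertices into the [b] components of [H].
    A weighted form of Cayley's formula says that the number of such [A] is
    [n ^ (b - 2)] times the number of transversals of that partition, that is
    of sets [R] of vertices of [X] which meet every component exactly once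
    ([card_clique_trees]).  It is proved by induction on [b]: count the pairs
    (tree, edge of that tree), and contract the edge.

    Choosing a transversal [R] amounts to joining a new vertex, in place of the
    clique, to the elements of [R]: this is the star-mesh transformation.  A
    vertex of [X] without an edge in [MX] is a component by itself, hence
    belongs to [R].  So [R] is determined by the set [M'] of the edges of [MX]
    with an end in [R], and [|R| = |X| - |MX| + |M'|].  Moreover [R] is a
    transversal exactly when replacing [MX] by [M'] gives a spanning tree of
    the graph where [X] is collapsed to a point.  This is [clique_collapse]:
    up to the factor [n ^ (2 + |MX|)], the trees through [MX] are counted by
    the trees of the collapsed graph with weight [n ^ (|X| + |M'|)].
    After all the cliques have been collapsed, [M'] has become the set of edges
    of the tree at the contracted vertex, and the product of the factors is the
    claimed one.

    All the intermediate graphs have the same edges and differ by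
      identifications
    of vertices.  They are therefore represented by the original graph with a
    labelling of its vertices, two vertices being identified when they have the
    same label; contracting a set of edges is a change of labelling. *)

Set Implicit Arguments.
Unset Strict Implicit.
Unset Printing Implicit Defensive.

(** * Spanning trees of labelled quotients *)

Section Images.
Variables (V L1 L2 : finType) (D : {set V}) (f : V -> L1) (g : V -> L2).

Lemma leq_card_imset_ker :
  {in D &, forall u v, f u = f v -> g u = g v} -> #|g @: D| <= #|f @: D|.
Proof.
move=> fg; have [->|[v0 v0D]] := set_0Vmem D; first by rewrite !imset0 !cards0.
pose h c := g (odflt v0 [pick v in D | f v == c]).
apply: leq_trans (leq_imset_card h (f @: D)); apply: subset_leq_card.
apply/subsetP=> _ /imsetP[v vD ->]; apply/imsetP; exists (f v).
  exact: imset_f.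
rewrite /h; case: pickP => [w /andP[wD /eqP fw]|/(_ v)] /=.
  exact: fg.
by rewrite vD eqxx.
Qed.

End Images.

Lemma card_imset_ker (V L1 L2 : finType) (D : {set V}) (f : V ->
  L1) (g : V -> L2) :
  {in D &, forall u v, (f u == f v) = (g u == g v)} -> #|f @: D| = #|g @: D|.
Proof.
move=> fg; apply/eqP; rewrite eqn_leq !leq_card_imset_ker //.
  by move=> u v uD vD fuv; apply/eqP; rewrite -fg // fuv.
by move=> u v uD vD fuv; apply/eqP; rewrite fg // fuv.
Qed.

(** The common form of the two ways in which vertices get identified here:
    adding an edge (then [X] is the pair of its ends) and collapsing a clique.
      *)
Lemma card_imset_collapse (V L1 L2 : finType) (D X : {set V})
    (f : V -> L1) (g : V -> L2) :
  X != set0 -> X \subset D ->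
  {in D &, forall u v, (g u == g v) =
     (f u == f v) || (f u \in f @: X) && (f v \in f @: X)} ->
  #|g @: D| + #|f @: X| = #|f @: D|.+1.
Proof.
case/set0Pn=> x0 x0X XD fg.
pose h c := if c \in f @: X then f x0 else c.
have fx0 : f x0 \in f @: X by apply: imset_f.
have -> : #|g @: D| = #|(h \o f) @: D|.
  apply: card_imset_ker => u v uD vD; rewrite fg //= /h.
  have [fu|fu] := ifPn; have [fv|fv] := ifPn.
  - by rewrite eqxx orbT.
  - rewrite /= orbF; apply/eqP/eqP=> Hf; first by rewrite -Hf fu in fv.
    by rewrite -Hf fx0 in fv.
  - rewrite /= orbF; apply/eqP/eqP=> Hf; first by rewrite Hf fv in fu.
    by rewrite Hf fx0 in fu.
  - by rewrite /= orbF.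
have -> : (h \o f) @: D = f x0 |: (f @: D :\: f @: X).
  apply/setP=> c; rewrite !inE; apply/imsetP/idP => [[v vD ->]|].
    by rewrite /= /h; case: ifPn => [|fv]; rewrite ?eqxx // fv imset_f ?orbT.
  case/orP=> [/eqP->|/andP[cX /imsetP[v vD cE]]].
    by exists x0; rewrite ?(subsetP XD) //= /h fx0.
  by exists v => //=; rewrite /h -cE (negPf cX).
rewrite cardsU1 !inE fx0 /= cardsD (setIidPr _) ?imsetS //.
have := subset_leq_card (imsetS f XD); lia.
Qed.

Section Joined.
Variables (V E : finType) (G : mgraph V E).
Local Notation D := (vset G).

Section Labelling.
Variables (L : finType) (psi : V -> L).
Implicit Types (A B : {set E}) (Z : {set V}).

Definition stable A Z : bool :=
  [forall u in D, forall v in D, (psi u == psi v) ==> (u \in Z) ==> (v \in Z)]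
    &&
  [forall e in A, forall u in ends G e, forall v in ends G e,
     (u \in Z) ==> (v \in Z)].

(** Connectivity by the edges of [A], in the graph where vertices with the same
    label are identified.  Saying that no stable set separates the two vertices
    makes this an equivalence relation at once, and reduces connectivity proofs
    to exhibiting an invariant set rather than handling paths. *)
Definition joined A : rel V :=
  fun u v => [forall Z : {set V}, stable A Z ==> ((u \in Z) == (v \in Z))].

(** Besides being the class of [v], this is a new label for [v]: the labelling
    [jclass A] represents the graph in which [A] has been contracted. *)
Definition jclass A v : {set V} := [set w in D | joined A v w].

Definition nclass A : nat := #|jclass A @: D|.

(** Acyclicity is expressed by the number of edges, so that the definition makes
    sense for every labelling; [tree_sptree] relates it to trees. *)
Definition sptree A : bool := (nclass A == 1) && (#|psi @: D| == #|A|.+1).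

Lemma stableP A Z :
  reflect ({in D &, forall u v, psi u = psi v -> u \in Z -> v \in Z} /\
           {in A, forall e, {in ends G e &, forall u v, u \in Z -> v \in Z}})
          (stable A Z).
Proof.
apply: (iffP andP) => -[HV HE]; split.
- move=> u v uD vD /eqP uv uZ; move/forall_inP/(_ u uD): HV.
  by move/forall_inP/(_ v vD)/implyP/(_ uv)/implyP/(_ uZ).
- move=> e eA u v ue ve uZ; move/forall_inP/(_ e eA)/forall_inP/(_ u ue): HE.
  by move/forall_inP/(_ v ve)/implyP/(_ uZ).
- apply/forall_inP=> u uD; apply/forall_inP=> v vD; apply/implyP=> /eqP uv.
  by apply/implyP; apply: HV.
- apply/forall_inP=> e eA; apply/forall_inP=> u ue; apply/forall_inP=> v ve.
  by apply/implyP; apply: (HE e eA u v ue ve).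
Qed.

Lemma joinedP A u v :
  reflect (forall Z, stable A Z -> (u \in Z) = (v \in Z)) (joined A u v).
Proof. by apply: (iffP forall_inP) => H Z sZ; apply/eqP; apply: H. Qed.

Lemma joined_refl A : reflexive (joined A).
Proof. by move=> u; apply/joinedP. Qed.

Lemma joined_sym A : symmetric (joined A).
Proof. by move=> u v; apply/joinedP/joinedP => H Z /H->. Qed.

Lemma joined_trans A : transitive (joined A).
Proof. by move=> v u w /joinedP uv /joinedP vw; apply/joinedP=> Z sZ;
  rewrite uv ?vw. Qed.

Lemma joined_label A u v : u \in D -> v \in D -> psi u = psi v -> joined A u v.
Proof.
move=> uD vD uv; apply/joinedP=> Z /stableP[H _].
by apply/idP/idP; apply: H.
Qed.

Lemma joined_edge A e u v :
  e \in A -> u \in ends G e -> v \in ends G e -> joined A u v.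
Proof.
move=> eA ue ve; apply/joinedP=> Z /stableP[_ H].
by apply/idP/idP; apply: H ve || apply: H ue.
Qed.

Lemma stable_class A u : stable A [set v | joined A u v].
Proof.
apply/stableP; split=> [v w vD wD vw|e eA v w ve we]; rewrite !inE => uv.
  by apply: joined_trans uv _; apply: joined_label.
by apply: joined_trans uv _; apply: joined_edge ve we.
Qed.

Lemma stable_sub A B Z : A \subset B -> stable B Z -> stable A Z.
Proof.
move=> AB /stableP[HV HE]; apply/stableP; split=> // e eA.
by apply: HE; apply: (subsetP AB).
Qed.

Lemma joined_sub A B u v : A \subset B -> joined A u v -> joined B u v.
Proof.
by move=> AB /joinedP H; apply/joinedP=> Z sZ; apply: H; apply: stable_sub sZ.
Qed.

Lemma joined0 u v : u \in D -> v \in D -> joined set0 u v = (psi u == psi v).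
Proof.
move=> uD vD; apply/joinedP/eqP => [|uv Z /stableP[H _]].
  have sZ : stable set0 [set w | psi w == psi u].
    by apply/stableP; split=> [w z wD zD wz|e]; rewrite !inE ?wz.
  by move/(_ _ sZ); rewrite !inE eqxx => /esym/eqP.
by apply/idP/idP; apply: H.
Qed.

Lemma jclass_eq A u v : u \in D -> v \in D ->
  (jclass A u == jclass A v) = joined A u v.
Proof.
move=> uD vD; apply/eqP/idP => [/setP/(_ v)|uv].
  by rewrite !inE vD joined_refl.
apply/setP=> w; rewrite !inE; congr (_ && _); apply/idP/idP.
  by apply: joined_trans; rewrite joined_sym.
exact: joined_trans.
Qed.

(** If [u] is near [e], the set of vertices near [e] is stable for [e |: A];
    otherwise the class of [u] for [A] already is. *)
Lemma joinedU1 A e u v : joined (e |: A) u v =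
  joined A u v || [exists x in ends G e, joined A u x] &&
                  [exists x in ends G e, joined A v x].
Proof.
set near := fun w => [exists x in ends G e, joined A w x].
have nearP w : reflect (exists2 x, x \in ends G e & joined A w x) (near w).
  exact: exists_inP.
rewrite -/(near u) -/(near v).
have nearJ w z : joined A w z -> near w -> near z.
  move=> wz /nearP[x xe wx]; apply/nearP; exists x => //.
  by apply: joined_trans wx; rewrite joined_sym.
apply/idP/orP=> [uv|[uv|/andP[/nearP[x xe ux] /nearP[y ye vy]]]].
- case nu: (near u); [right|left].
    have st : stable (e |: A) [set w | near w].
      apply/stableP; split=> [w z wD zD wz|f].
        by rewrite !inE; apply: nearJ; apply: joined_label.
      rewrite !inE => /predU1P[->|fA] w z we ze; rewrite !inE.
        by move=> _; apply/nearP; exists z; rewrite ?joined_refl.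
      by apply: nearJ; apply: joined_edge we ze.
    by have := joinedP _ _ _ uv _ st; rewrite !inE nu => <-.
  suff st : stable (e |: A) [set w | joined A u w].
    by have := joinedP _ _ _ uv _ st; rewrite !inE joined_refl => <-.
  apply/stableP; have /stableP[HV HE] := stable_class A u; split=> // f.
  rewrite !inE => /predU1P[->|fA]; last exact: HE.
  move=> w z we ze; rewrite !inE => uw; suff: near u by rewrite nu.
  by apply/nearP; exists w.
- by apply: joined_sub uv; apply: subsetUr.
have AeA := subsetUr [set e] A.
apply: joined_trans (joined_sub AeA ux) _; apply: (@joined_trans _ y).
  by apply: joined_edge xe ye; rewrite !inE eqxx.
by rewrite joined_sym; apply: joined_sub vy.
Qed.

Lemma nclass0 : nclass set0 = #|psi @: D|.
Proof. by apply: card_imset_ker => u v uD vD; rewrite jclass_eq ?joined0. Qed.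

Lemma ends_neq0 e : e \in eset G -> ends G e != set0.
Proof. by move/ends_card=> c2; rewrite -card_gt0 c2. Qed.

(** Adding [e] merges the classes which meet [ends G e] into one. *)
Lemma nclassU1 A e : e \in eset G ->
  nclass (e |: A) + #|jclass A @: ends G e| = (nclass A).+1.
Proof.
move=> eG; have eD := ends_sub eG.
apply: card_imset_collapse => //; first exact: ends_neq0.
have nearE w : w \in D ->
    (jclass A w \in jclass A @: ends G e) =
      [exists x in ends G e, joined A w x].
  move=> wD; apply/imsetP/exists_inP=> -[x xe].
    by move/eqP; rewrite jclass_eq // ?(subsetP eD) //; move=> wx; exists x.
  by move=> wx; exists x => //; apply/eqP; rewrite jclass_eq // (subsetP eD).
by move=> u v uD vD; rewrite !jclass_eq // !nearE // joinedU1.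
Qed.

Lemma nclassU1_bounds A e : e \in eset G ->
  nclass (e |: A) <= nclass A <= (nclass (e |: A)).+1.
Proof.
move=> eG; have := nclassU1 A eG; have := leq_imset_card (jclass A) (ends G e).
have : 0 < #|jclass A @: ends G e|.
  by have /set0Pn[x xe] := ends_neq0 eG; apply/card_gt0P; exists (jclass A x);
    apply: imset_f.
rewrite (ends_card eG); lia.
Qed.

Lemma nclassU1_joined A e u v : e \in eset G -> ends G e = [set u; v] ->
  nclass A = nclass (e |: A) + ~~ joined A u v.
Proof.
move=> eG e_uv; have := nclassU1 A eG; have := ends_sub eG.
rewrite e_uv imsetU1 imset_set1 cards2 => /subsetP sD.
by rewrite jclass_eq ?sD ?inE ?eqxx ?orbT //; lia.
Qed.

Lemma nclass_rank A : A \subset eset G -> #|psi @: D| <= nclass A + #|A|.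
Proof.
move En: #|A| => n; elim: n A En => [|n IH] A.
  by move/eqP; rewrite cards_eq0 => /eqP-> _; rewrite nclass0 addn0.
move=> cA AG; have /card_gt0P[e eA] : 0 < #|A| by rewrite cA.
have := IH (A :\ e); rewrite (cardsD1 e) eA in cA; case: cA => cA.
move/(_ cA (subset_trans (subsetDl _ _) AG)).
have := nclassU1_bounds (A :\ e) (subsetP AG e eA); rewrite setD1K //; lia.
Qed.

End Labelling.

Implicit Types (A B : {set E}) (Z : {set V}).

Lemma stable_jclass (L : finType) (psi : V -> L) A B Z : A \subset eset G ->
  stable (jclass psi A) B Z = stable psi (A :|: B) Z.
Proof.
move=> AG; apply/stableP/stableP=> -[HV HE].
  split=> [u v uD vD uv|e]; last first.
    case/setUP=> [eA|]; last exact: HE.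
    have eD := subsetP (ends_sub (subsetP AG e eA)).
    move=> u v ue ve; apply: HV; rewrite ?eD //; apply/eqP.
    by rewrite jclass_eq ?eD //; apply: joined_edge ue ve.
  by apply: HV => //; apply/eqP; rewrite jclass_eq //; apply: joined_label.
split=> [u v uD vD /eqP|e eB]; last by apply: HE; rewrite inE eB orbT.
rewrite jclass_eq // => /joinedP-> //; apply/stableP; split=> // e eA.
by apply: HE; rewrite inE eA.
Qed.

Lemma joined_jclass (L : finType) (psi : V -> L) A B u v : A \subset eset G ->
  joined (jclass psi A) B u v = joined psi (A :|: B) u v.
Proof. by move=> AG; apply: eq_forallb => Z; rewrite stable_jclass. Qed.

Lemma nclass_jclass (L : finType) (psi : V -> L) A B : A \subset eset G ->
  nclass (jclass psi A) B = nclass psi (A :|: B).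
Proof.
move=> AG; rewrite /nclass; apply: card_imset_ker => u v uD vD.
by rewrite !jclass_eq // joined_jclass.
Qed.

(** Contracting part of a tree.  The first conjunct expresses that [A] is
    independent; it is forced because each edge lowers the number of classes by
    at most one. *)
Lemma sptreeU (L : finType) (psi : V -> L) A B :
  A \subset eset G -> B \subset eset G -> [disjoint A & B] ->
  sptree psi (A :|: B) =
    (#|psi @: D| == nclass psi A + #|A|) && sptree (jclass psi A) B.
Proof.
move=> AG BG dAB; rewrite /sptree nclass_jclass //.
have cU : #|A :|: B| = #|A| + #|B|.
  by rewrite cardsU (disjoint_setI0 dAB) cards0 subn0.
have := nclass_rank psi AG; have := nclass_rank (jclass psi A) BG.
rewrite nclass_jclass // cU -/(nclass psi A).
by case: eqP => [->|]; rewrite /= ?andbF // => *; apply/eqP/andP;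
  rewrite ?eqn_leq; lia.
Qed.

End Joined.

(** * Acyclicity by counting, and quotients of graphs *)

Section Trees.
Variables (V E : finType).
Implicit Types (G : mgraph V E) (A B C T : {set E}).

Lemma joined_connect G u v :
  joined G id (eset G) u v = connect (adjacent G) u v.
Proof.
apply/idP/idP => [/joinedP uv|uv].
  suff st : stable G id (eset G) [set w | connect (adjacent G) u w].
    by have := uv _ st; rewrite !inE connect0 => <-.
  apply/stableP; split=> [w z _ _ ->|e eG w z we ze] //; rewrite !inE => uw.
  have [<- //|wz] := eqVneq w z; apply: connect_trans uw (connect1 _).
  apply/existsP; exists e; rewrite eG eq_sym eqEcard cards2 wz (ends_card eG)
    andbT.
  by apply/subsetP=> x; rewrite !inE => /pred2P[] ->.
apply/joinedP=> Z /stableP[_ HE]; apply: closed_connect uv => x y.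
case/existsP=> e /andP[eG /eqP xy].
by apply/idP/idP; apply: (HE e eG); rewrite xy !inE eqxx ?orbT.
Qed.

Lemma nclass_eq1 (L : finType) G (psi : V -> L) A : (nclass G psi A == 1) =
  (vset G != set0) && [forall u in vset G, forall v in vset G, joined G psi A u
    v].
Proof.
apply/cards1P/andP=> [[c Hc]|[/set0Pn[u uG] /forall_inP H]].
  split; first by apply/eqP=> D0; move/setP: Hc => /(_ c);
    rewrite D0 imset0 !inE eqxx.
  apply/forall_inP=> u uG; apply/forall_inP=> v vG; rewrite -jclass_eq //.
  have: jclass G psi A u \in [set c] by rewrite -Hc imset_f.
  have: jclass G psi A v \in [set c] by rewrite -Hc imset_f.
  by rewrite !inE => /eqP-> /eqP->.
exists (jclass G psi A u); apply/setP=> c; rewrite inE.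
apply/imsetP/eqP=> [[v vG ->]|->]; last by exists u.
by apply/eqP; rewrite jclass_eq //; apply: (forall_inP (H v vG)).
Qed.

Lemma connected_nclass G : connected G = (nclass G id (eset G) == 1).
Proof.
rewrite nclass_eq1; congr (_ && _); apply: eq_forallb => u; congr (_ ==> _).
by apply: eq_forallb => v; rewrite joined_connect.
Qed.

Lemma handshake G : \sum_(v in vset G) #|incident G v| = (#|eset G|).*2.
Proof.
under eq_bigr => v _ do rewrite -sum1_card big_mkcond /=.
rewrite exchange_big /= -mul2n mulnC -sum_nat_const [RHS]big_mkcond /=.
apply: eq_bigr => e _; rewrite -big_mkcondr sum1dep_card.
case: ifP => eG; last by apply: eq_card0 => v; rewrite !inE eG /= andbF.
rewrite -(ends_card eG); apply: eq_card => v; rewrite !inE eG /=.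
by rewrite andb_idl //; apply/subsetP/ends_sub.
Qed.

Lemma joined_isolated G A v w :
  {in A, forall e, v \notin ends G e} -> joined G id A v w -> v = w.
Proof.
move=> isol /joinedP vw.
suff st : stable G id A [set v].
  by apply/esym/eqP; have := vw _ st; rewrite !inE eqxx.
apply/stableP; split=> [x y _ _ ->|e eA x y xe ye] //.
by rewrite !inE => /eqP xv; have := isol e eA; rewrite -xv xe.
Qed.

(** A vertex outside [G[C]] is a class by itself, and the other classes are the
    components of [G[C]]. *)
Lemma nclass_edge_induced G C : C \subset eset G ->
  nclass G id C + #|vset (edge_induced G C)| =
  nclass (edge_induced G C) id C + #|vset G|.
Proof.
move=> CG; set H := edge_induced G C.
have HG : vset H \subset vset G.
  by apply/bigcupsP=> e /setIP[eG _]; apply: ends_sub.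
have nin v : v \notin vset H -> {in C, forall e, v \notin ends G e}.
  move=> vH e eC; apply: contra vH => ve; apply/bigcupP; exists e => //.
  by rewrite inE eC (subsetP CG).
have -> : nclass H id C = #|jclass G id C @: vset H|.
  apply: card_imset_ker => u v uH vH.
  by rewrite !jclass_eq // ?(subsetP HG) //; apply: eq_forallb => Z;
    congr (_ ==> _);
     apply/stableP/stableP=> -[_ ?]; split=> // ? ? _ _ ->.
rewrite /nclass -{1}(setID (vset G) (vset H)) (setIidPr HG) imsetU cardsU.
set I := _ :&: _; have -> : I = set0.
  rewrite {}/I; apply/setP=> c; rewrite !inE;
    apply/andP=> -[/imsetP[u uH ->] /imsetP[v]].
  rewrite !inE => /andP[vH vG] /esym/eqP; rewrite jclass_eq // ?(subsetP HG) //.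
  by move/(joined_isolated (nin v vH)) => vu; rewrite vu uH in vH.
rewrite (@card_in_imset _ _ _ (vset G :\: vset H)); last first.
  move=> u v; rewrite !inE => /andP[uH uG] /andP[_ vG] /eqP.
  by rewrite jclass_eq //; apply: joined_isolated; apply: nin.
rewrite cards0 cardsD (setIidPr HG); have := subset_leq_card HG; lia.
Qed.

(** The quantity [nclass A + #|A|] is the number of classes for the empty set
    plus the number of independent cycles of [A]. *)
Lemma nclass_excess (L : finType) G (psi : V -> L) A B :
  A \subset B -> B \subset eset G ->
  nclass G psi A + #|A| <= nclass G psi B + #|B|.
Proof.
move=> AB BG; have AG := subset_trans AB BG.
have := nclass_rank (jclass G psi A) (subset_trans (subsetDl B A) BG).
rewrite nclass_jclass // -/(nclass G psi A) setDE setUIr setUCr setIT 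
  (setUidPr AB) -setDE.
rewrite cardsD (setIidPr AB); have := subset_leq_card AB; lia.
Qed.

(** A cycle is connected with as many edges as vertices, so it makes the
    right hand side exceed the left one, and larger edge sets keep the excess by
    [nclass_excess].  Conversely, let [C] be a minimal edge set for which the
    equality fails.  Deleting an edge from [C] does not disconnect
    anything, so in [G[C]] all degrees are at least 2; and [C] has exactly one
    edge more than a forest with the same components, so the handshake identity
    leaves room only for degrees equal to 2 and a single component. *)
Lemma acyclic_nclass G :
  acyclic G = (#|vset G| == nclass G id (eset G) + #|eset G|).
Proof.
have ncl_set0 : nclass G id set0 = #|vset G| by rewrite nclass0 imset_id.
apply/idP/idP=> [acG|/eqP cG].
  apply: contraTT acG => nG.
  pose P C := (C \subset eset G) && (#|vset G| != nclass G id C + #|C|).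
  have PG : P (eset G) by rewrite /P subxx.
  have [C /minsetP[/andP[CG nC] minC] _] := minset_exists PG.
  have indD e : e \in C -> #|vset G| = nclass G id (C :\ e) + #|C :\ e|.
    move=> eC; apply/eqP; apply: contraTT eC => nD.
    rewrite -(minC (C :\ e)) ?subsetDl ?inE ?eqxx //.
    by rewrite /P nD andbT (subset_trans (subsetDl _ _)).
  (* C is not independent but C :\ e is, so e closes a cycle. *)
  have nclD e : e \in C -> nclass G id (C :\ e) = nclass G id C.
    move=> eC; have := nclassU1_bounds id (C :\ e) (subsetP CG e eC).
    have := indD e eC; have := cardsD1 e C.
    rewrite setD1K // eC; move/eqP: nC; lia.
  have [e0 e0C] : exists e, e \in C.
    apply/set0Pn; apply: contraNneq nC => ->; rewrite ncl_set0 cards0; lia.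
  have cC : nclass G id C + #|C| = #|vset G|.+1.
    have := indD e0 e0C; rewrite nclD //; move: (cardsD1 e0 C); rewrite e0C;
      lia.
  set H := edge_induced G C.
  have eH : eset H = C by apply/setIidPr.
  (* Deleting the only edge at a vertex would split off that vertex. *)
  have degH v : v \in vset H -> 2 <= #|incident H v|.
    case/bigcupP=> e; rewrite inE => /andP[eG eC] ve.
    have eI : e \in incident H v by rewrite inE eH eC.
    rewrite (cardsD1 e) eI ltnS card_gt0; apply/eqP=> I0.
    have e2 : #|ends G e| == 2 by rewrite ends_card.
    have [w we wv] : exists2 w, w \in ends G e & w != v.
      have : 0 < #|ends G e :\ v| by move: e2; rewrite (cardsD1 v) ve;
        case: #|_|.
      by case/card_gt0P=> w; rewrite !inE => /andP[]; exists w.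
    have e_vw : ends G e = [set v; w].
      apply/eqP; rewrite eq_sym eqEcard cards2 eq_sym wv (eqP e2) andbT.
      by apply/subsetP=> x; rewrite !inE => /pred2P[] ->.
    have := nclassU1_joined id (C :\ e) eG e_vw; rewrite setD1K // nclD //.
    case: (boolP (joined _ _ _ _ _)) => [vw _|_]; last by lia.
    case/eqP: wv; apply/esym; apply: joined_isolated vw => f.
    rewrite !inE => /andP[fe fC]; apply/negP=> vf.
    by move/setP: I0 => /(_ f); rewrite in_set0 in_setD1 fe inE eH fC vf.
  have := nclass_edge_induced CG; rewrite -/H => cH.
  have V0 : 0 < nclass H id C.
    apply/card_gt0P; have /set0Pn[v ve] := ends_neq0 (subsetP CG e0 e0C).
    exists (jclass H id C v); apply/imset_f/bigcupP; exists e0 => //.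
    by rewrite inE e0C (subsetP CG).
  have := handshake H; rewrite eH => hs.
  have := leqif_sum (fun v vH => (leqif_eq (degH v vH))).
  case; rewrite hs sum_nat_const => le eqv.
  have CV : #|C| = #|vset H| by lia.
  apply/forallPn; exists C; rewrite CG /= negbK; apply/andP; split.
    rewrite connected_nclass -/H eH; apply/eqP; lia.
  move: eqv; rewrite CV muln2 eqxx => /esym/forall_inP degE.
  by apply/forall_inP=> v vH; rewrite eq_sym degE.
apply/forall_inP=> C CG; apply/negP=> /andP[].
set H := edge_induced G C; have eH : eset H = C by apply/setIidPr.
rewrite connected_nclass eH => /eqP c1 /forall_inP deg2.
have := handshake H; rewrite eH (eq_bigr (fun=> 2)); last by move=> v /deg2/eqP.
have := nclass_edge_induced CG; rewrite -/H c1 sum_nat_const.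
have := nclass_excess id CG (subxx _); lia.
Qed.

Lemma tree_sptree G T : T \subset eset G -> tree (spanning G T) = sptree G id T.
Proof.
move=> TG; have eT : eset (spanning G T) = T by apply/setIidPr.
rewrite /tree connected_nclass acyclic_nclass eT /sptree imset_id.
have -> : nclass (spanning G T) id T = nclass G id T by [].
by case: eqP => // ->; rewrite add1n.
Qed.

End Trees.

Section Quotient.
Variables (V W E : finType) (G : mgraph V E) (H : mgraph W E) (q : V -> W).
Variable (A : {set E}).
Hypotheses (AG : A \subset eset G) (Hq : vset H = q @: vset G).
Hypothesis ends_q : {in A, forall e, ends H e = q @: ends G e}.

Lemma joined_quotient u v : u \in vset G -> v \in vset G ->
  joined H id A (q u) (q v) = joined G q A u v.
Proof.
move=> uG vG; apply/joinedP/joinedP=> HZ Z /stableP[HV HE].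
  have memq w : w \in vset G -> (q w \in q @: (Z :&: vset G)) = (w \in Z).
    move=> wG; apply/imsetP/idP=> [[z]|wZ]; last by exists w; rewrite // inE wZ.
    by rewrite inE => /andP[zZ zG] wz; apply: HV zZ.
  rewrite -!memq //; apply: HZ; apply/stableP; split=> [w z _ _ ->|e eA] //.
  have eG := subsetP (ends_sub (subsetP AG e eA)).
  rewrite ends_q // => _ _ /imsetP[w we ->] /imsetP[z ze ->].
  by rewrite !memq ?eG //; apply: (HE e).
have := HZ (q @^-1: Z); rewrite !inE; apply; apply/stableP.
split=> [w z wG zG wz|e eA w z we ze]; rewrite !inE ?wz //.
by apply: (HE e eA); rewrite ends_q // imset_f.
Qed.

(** This lets a contracted graph, whose vertices are sets of vertices of [G],
    be treated as a labelling of [G]. *)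
Lemma sptree_quotient : sptree H id A = sptree G q A.
Proof.
rewrite /sptree imset_id Hq; congr (_ && _); congr (_ == _).
rewrite /nclass Hq -imset_comp; apply: card_imset_ker => u v uG vG /=.
by rewrite !jclass_eq ?Hq ?imset_f // joined_quotient.
Qed.

End Quotient.

(** * Trees in a clique modulo a labelling *)

Section Link.
Variables (V E L : finType) (G : mgraph V E) (psi : V -> L).
Implicit Types (e : E) (A B : {set E}).

Lemma ends_pairP e : e \in eset G ->
  exists x y, [/\ x != y, ends G e = [set x; y], x \in vset G & y \in vset G].
Proof.
move=> eG; have /cards2P[x [y [xy exy]]] : #|ends G e| == 2 by rewrite
  ends_card.
exists x, y; split=> //; apply: (subsetP (ends_sub eG));
  rewrite exy !inE eqxx //.
by rewrite orbT.
Qed.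

(** The edge [e] is not a loop of the quotient by [psi]; see [linkE]. *)
Definition link e := #|psi @: vset G| == (nclass G psi [set e]).+1.

Lemma linkE e x y : e \in eset G -> ends G e = [set x; y] ->
  link e = (psi x != psi y).
Proof.
move=> eG exy; have sD := subsetP (ends_sub eG).
have [xG yG] : x \in vset G /\ y \in vset G by rewrite !sD // exy !inE eqxx
  ?orbT.
have := nclassU1_joined psi set0 eG exy;
  rewrite setU0 joined0 // nclass0 /link => ->.
by case: (psi x == psi y) => /=; lia.
Qed.

Lemma sptreeU1 e A : e \in eset G -> A \subset eset G -> e \notin A ->
  sptree G psi (e |: A) = link e && sptree G (jclass G psi [set e]) A.
Proof.
move=> eG AG eA; rewrite sptreeU ?sub1set ?disjoints1 //.
by rewrite cards1 addn1.
Qed.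

(** Once contracted, [e] is a loop, and a tree contains no loop. *)
Lemma sptree_jclass1 e A : A \subset eset G ->
  sptree G (jclass G psi [set e]) A -> e \notin A.
Proof.
move=> AG; apply: contraTN => eA; have eG := subsetP AG e eA.
rewrite /sptree -/(nclass G psi [set e]) -(setD1K eA) nclass_jclass ?sub1set //.
rewrite setUA setUid cardsU1 !inE eqxx add1n negb_and -implybE.
apply/implyP=> /eqP c1; apply/eqP.
have sub : A :\ e \subset eset G := subset_trans (subsetDl _ _) AG.
have := nclass_rank (jclass G psi [set e]) sub;
  rewrite -/(nclass G psi [set e]).
rewrite nclass_jclass ?sub1set // c1; lia.
Qed.

Lemma joined1 e u v : e \in eset G -> u \in vset G -> v \in vset G ->
  joined G psi [set e] u v = (psi u == psi v) ||
     (psi u \in psi @: ends G e) && (psi v \in psi @: ends G e).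
Proof.
move=> eG uG vG; have sD := subsetP (ends_sub eG).
rewrite -(setU0 [set e]) joinedU1 joined0 //.
have nearE w : w \in vset G ->
    [exists x in ends G e, joined G psi set0 w x] = (psi w \in psi @: ends G e).
  move=> wG; apply/exists_inP/imsetP=> -[x xe].
    by rewrite joined0 // ?sD // => /eqP wx; exists x.
  by move=> wx; exists x; rewrite // joined0 // ?sD // wx.
by rewrite !nearE.
Qed.

End Link.

Section Transversal.
Variables (V : finType) (D X : {set V}).

Section Label.
Variables (L : finType) (psi : V -> L).

(** Transversals of the partition of [D] by [psi], with elements taken in [X]. *)
Definition label_transversal (R : {set V}) : bool :=
  [&& R \subset X, [forall r in R, forall s in R, (psi r == psi s) ==> (r == s)]
    & [forall v in D, exists r in R, psi r == psi v]].

Lemma label_transversalP (R : {set V}) :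
  reflect [/\ R \subset X, {in R &, injective psi} &
              {in D, forall v, exists2 r, r \in R & psi r = psi v}]
          (label_transversal R).
Proof.
apply: (iffP and3P) => -[RX inj onto]; split=> //.
- move=> r s rR sR /eqP rs; apply/eqP.
  by move/forall_inP/(_ r rR)/forall_inP/(_ s sR)/implyP: inj; apply.
- move=> v vD; have /exists_inP[r rR /eqP rv] := forall_inP onto v vD.
  by exists r.
- apply/forall_inP=> r rR; apply/forall_inP=> s sR; apply/implyP=> /eqP rs.
  by apply/eqP/inj.
- apply/forall_inP=> v vD; have [r rR rv] := onto v vD.
  by apply/exists_inP; exists r; rewrite ?rv.
Qed.

Lemma card_label_transversal (R : {set V}) : X \subset D ->
  label_transversal R -> #|R| = #|psi @: D|.
Proof.
move=> XD /label_transversalP[RX inj onto]; rewrite -(card_in_imset inj).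
congr #|pred_of_set _|; apply/eqP;
  rewrite eqEsubset imsetS ?(subset_trans RX) //=.
by apply/subsetP=> _ /imsetP[v vD ->]; have [r rR <-] := onto v vD;
  apply: imset_f.
Qed.

Lemma sum_fibre (R : {set V}) : X \subset D -> label_transversal R ->
  \sum_(y in R) #|[set x in X | psi x == psi y]| = #|X|.
Proof.
move=> XD /label_transversalP[RX inj onto].
rewrite -[RHS]sum1_card.
under eq_bigr => y _ do rewrite -sum1dep_card big_mkcondr /=.
rewrite exchange_big /=; apply: eq_bigr => x xX.
have [r rR rx] := onto x (subsetP XD x xX).
rewrite -big_mkcondr (big_pred1 r) // => y /=;
  apply/andP/eqP=> [[yR /eqP xy]|->].
  by apply: inj; rewrite // -xy rx.
by rewrite rR rx eqxx.
Qed.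

End Label.

End Transversal.

Section TransversalMerge.
Variables (V L L' : finType) (D X : {set V}) (psi : V -> L) (chi : V -> L').
Hypothesis XD : X \subset D.

Definition merging (x y : V) : Prop := {in D &, forall u v,
  (chi u == chi v) = (psi u == psi v) ||
    ((psi u == psi x) || (psi u == psi y)) &&
    ((psi v == psi x) || (psi v == psi y))}.

(** A transversal for [psi] containing [y] has another element in the class of
    [x]; removing [y] from it leaves a transversal for the merged labelling
    which avoids the class of [y], and this is reversible. *)
Lemma card_transversal_half x y : x \in X -> y \in X ->
  psi x != psi y -> merging x y ->
  #|[set R | label_transversal D X chi R && [forall r in R, psi r != psi y]]| =
  #|[set R | label_transversal D X psi R && (y \in R)]|.
Proof.
move=> xX yX xy chiE.
set S := [set R : {set V} | _ && (y \in R)].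
have injS : {in S &, injective (fun R : {set V} => R :\ y)}.
  move=> R R'; rewrite !inE => /andP[_ yR] /andP[_ yR'] RR'.
  by rewrite -(setD1K yR) RR' setD1K.
rewrite -(card_in_imset injS); apply: eq_card => R'; rewrite inE.
have XinD := subsetP XD.
apply/andP/imsetP=> [[/label_transversalP[RX inj onto] /forall_inP miss]|[R]].
  have RinD r : r \in R' -> r \in D by move=> rR; rewrite XinD ?(subsetP RX).
  have yR : y \notin R' by apply/negP=> /miss; rewrite eqxx.
  exists (y |: R'); last by rewrite setU1K.
  rewrite !inE eqxx /= andbT; apply/label_transversalP; split.
  - by rewrite subUset sub1set yX.
  - move=> r s; rewrite !inE => /predU1P[->|rR] /predU1P[->|sR] // rs.
    + by case/eqP: (miss s sR).
    + by case/eqP: (miss r rR).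
    by apply: inj; rewrite // -?rs //; apply/eqP;
      rewrite chiE // ?RinD // rs eqxx.
  - move=> v vD; have [r rR /eqP] := onto v vD.
    rewrite chiE // ?RinD //; case/orP=> [/eqP rv|]; first by exists r;
      rewrite // inE rR orbT.
    rewrite (negPf (miss r rR)) orbF => /andP[/eqP rx /pred2P[vx|vy]].
      by exists r; rewrite ?inE ?rR ?orbT // rx vx.
    by exists y; rewrite ?inE ?eqxx.
rewrite inE => /andP[/label_transversalP[RX inj onto] yR ->].
have RinD r : r \in R -> r \in D by move=> rR; rewrite XinD ?(subsetP RX).
have miss r : r \in R :\ y -> psi r != psi y.
  by rewrite !inE => /andP[ry rR]; apply: contra ry => /eqP/inj->.
split; last by apply/forall_inP.
apply/label_transversalP; split.
- exact: subset_trans (subsetDl _ _) RX.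
- move=> r s rR' sR' /eqP; have [/setD1P[_ rR] /setD1P[_ sR]] := (rR', sR').
  rewrite chiE // ?RinD // (negPf (miss _ rR')) (negPf (miss _ sR')) !orbF.
  by case/orP=> [/eqP/inj->|/andP[/eqP rx /eqP sx]] //; apply: inj;
    rewrite // rx.
move=> v vD; have [r rR rv] := onto v vD.
have [ry|ry] := eqVneq r y; last first.
  exists r; first by rewrite !inE ry.
  by apply/eqP; rewrite chiE // ?RinD // rv eqxx.
have [s sR sx] := onto x (XinD x xX); exists s.
  by rewrite !inE sR andbT; apply: contra xy => /eqP<-; rewrite sx.
by apply/eqP; rewrite chiE // ?RinD // sx -rv ry !eqxx !orbT.
Qed.

(** A transversal for the merged labelling meets exactly one of the classes of
    [x] and [y], whence the two cases. *)
Lemma card_transversal_merge x y : x \in X -> y \in X ->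
  psi x != psi y -> merging x y ->
  #|[set R | label_transversal D X chi R]| =
  #|[set R | label_transversal D X psi R && (x \in R)]| +
  #|[set R | label_transversal D X psi R && (y \in R)]|.
Proof.
move=> xX yX xy chiE.
have yx : psi y != psi x by rewrite eq_sym.
rewrite -(card_transversal_half xX yX xy chiE).
rewrite -(card_transversal_half yX xX yx); last first.
  by move=> u v uD vD; rewrite chiE // (orbC (psi u == psi x)) (orbC (psi v ==
    psi x)).
rewrite addnC -(cardsID [set R : {set V} | [forall r in R, psi r != psi y]]).
congr (_ + _); apply: eq_card => R; rewrite !inE //.
rewrite andbC; case: (boolP (label_transversal _ _ chi R)) => //= tR.
have /label_transversalP[RX inj onto] := tR.
have RinD r : r \in R -> r \in D by move=> rR;
  rewrite (subsetP XD) ?(subsetP RX).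
have [r rR /eqP] := onto x (subsetP XD x xX); have xD := subsetP XD x xX.
rewrite chiE // ?RinD // eqxx andbT orbA orbb => rxy.
have rE s : s \in R -> (psi s == psi x) || (psi s == psi y) -> s = r.
  move=> sR sxy; apply: inj => //; apply/eqP.
  by rewrite chiE // ?RinD // sxy rxy orbT.
case/orP: rxy => /eqP rz.
  transitivity false.
    apply/negbTE; rewrite negbK; apply/forall_inP=> s sR; apply/negP=> sy.
    by move: (sy); rewrite (rE s sR) ?sy ?orbT // rz (negPf xy).
  by apply/esym/negbTE/negP=> /forall_inP/(_ r rR); rewrite rz eqxx.
transitivity true.
  by apply/negP=> /forall_inP/(_ r rR); rewrite rz eqxx.
apply/esym/forall_inP=> s sR; apply/negP=> sx.
by move: (sx); rewrite (rE s sR) ?sx // rz eq_sym (negPf xy).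
Qed.

End TransversalMerge.

Section Clique.
Variables (V E : finType) (G : mgraph V E) (X : {set V}) (EX : {set E}).
Local Notation D := (vset G).
Hypotheses (XG : X \subset D) (X0 : X != set0) (EXG : EX \subset eset G).
Hypothesis EX_ends : {in EX, forall e, ends G e \subset X}.
Hypothesis EX_simple : {in X &, forall x y, x != y ->
  #|[set e in EX | ends G e == [set x; y]]| = 1}.

Section Label.
Variables (L : finType) (psi : V -> L).

Definition clique_trees : {set {set E}} :=
  [set A : {set E} | (A \subset EX) && sptree G psi A].

Definition label_transversals : {set {set V}} :=
  [set R : {set V} | label_transversal D X psi R].

(** In a clique the edges at [y] correspond to their other ends. *)
Lemma card_link_at y : y \in X ->
  #|[set e in EX | link G psi e && (y \in ends G e)]| =
  #|[set x in X | psi x != psi y]|.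
Proof.
move=> yX.
have -> : #|[set x in X | psi x != psi y]| =
    \sum_(x in X | psi x != psi y) \sum_(e in EX) (ends G e == [set y; x]).
  rewrite -sum1dep_card; apply: eq_bigr => x /andP[xX xy].
  rewrite -(EX_simple yX xX) -?sum1dep_card ?big_mkcondr //.
  by apply: contra xy => /eqP->.
rewrite exchange_big -sum1dep_card big_mkcondr /=; apply: eq_bigr => e eEX.
have eG := subsetP EXG e eEX.
have [a [b [ab e_ab _ _]]] := ends_pairP eG.
rewrite (linkE psi eG e_ab).
case: ifP => [|nly].
  rewrite e_ab !inE => /andP[ab' /orP yab].
  have [z [zX yz e_yz]] : exists z, [/\ z \in X, psi z != psi y & ends G e =
    [set y; z]].
    have := EX_ends eEX; rewrite e_ab subUset !sub1set => /andP[aX bX].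
    case: yab => /eqP->; [exists b|exists a]; split=> //;
      first by rewrite eq_sym.
    exact: setUC.
  rewrite (bigD1 z) ?zX //= -e_ab e_yz eqxx big1 // => x /andP[_ xz].
  apply/eqP; rewrite eqb0; apply: contra xz => /eqP/setP/(_ z).
  rewrite !inE eqxx orbT => /esym/orP[/eqP zy|]; last by rewrite eq_sym.
  by rewrite zy eqxx in yz.
rewrite big1 // => x /andP[xX xy]; apply/eqP; rewrite eqb0.
apply: contraFN nly => /eqP e_yx; rewrite e_yx !inE eqxx /= andbT.
by rewrite -(linkE psi eG e_ab) (linkE psi eG e_yx) eq_sym.
Qed.

(** For a fixed transversal [R], summing the number of vertices of [X] outside
    the class of [y] over the elements [y] of [R] gives [#|R| * #|X| - #|X|]. *)
Lemma sum_transversals :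
  \sum_(e in EX | link G psi e) \sum_(y in ends G e)
     #|[set R in label_transversals | y \in R]| =
  #|label_transversals| * (#|X| * #|psi @: D|.-1).
Proof.
transitivity (\sum_(R in label_transversals) \sum_(y in R)
                #|[set e in EX | link G psi e && (y \in ends G e)]|).
  under eq_bigr => e _ do under eq_bigr => y _ do
    rewrite -sum1dep_card big_mkcondr /=.
  under eq_bigr => e _ do rewrite exchange_big /=.
  rewrite exchange_big /=; apply: eq_bigr => R _.
  under [RHS]eq_bigr => y _ do rewrite -sum1dep_card (eq_bigl _ _ (fun e =>
    andbA _ _ _)) big_mkcondr /=.
  rewrite exchange_big /=.
  under eq_bigr => e _ do rewrite -big_mkcondr /=.
  apply: eq_big => // e _; rewrite -big_mkcondr /=.
  by apply: eq_bigl => y; rewrite andbC.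
rewrite -sum_nat_const; apply: eq_bigr => R; rewrite inE => tR.
have /and3P[RX _ _] := tR.
rewrite (eq_bigr _ (fun y yR => card_link_at (subsetP RX y yR))).
have := sum_fibre XG tR; rewrite -(card_label_transversal XG tR) => fib.
have : \sum_(y in R) #|X| = #|R| * #|X| by rewrite sum_nat_const.
rewrite (eq_bigr (fun y => #|[set x in X | psi x == psi y]| +
                           #|[set x in X | psi x != psi y]|)); last first.
  move=> y _; rewrite -(cardsID [set x | psi x == psi y] X).
  by congr (_ + _); apply: eq_card => x; rewrite !inE // andbC.
rewrite big_split /= fib; case: #|R| => [|m]; nia.
Qed.

(** A tree through [e] is a tree of the graph in which [e] is contracted, and
    there is none if [e] is a loop. *)
Lemma count_clique_trees_mem e : e \in EX ->
  #|[set A in clique_trees | e \in A]| =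
  if link G psi e then #|[set A : {set E} | (A \subset EX) &&
    sptree G (jclass G psi [set e]) A]|
  else 0.
Proof.
move=> eEX; have eG := subsetP EXG e eEX.
set S := [set A in clique_trees | e \in A].
have injS : {in S &, injective (fun A : {set E} => A :\ e)}.
  move=> A A'; rewrite !inE => /andP[_ eA] /andP[_ eA'] AA'.
  by rewrite -(setD1K eA) AA' setD1K.
have SE (A : {set E}) : e \notin A -> (e |: A \in S) =
    [&& link G psi e, A \subset EX & sptree G (jclass G psi [set e]) A].
  move=> eA; rewrite !inE eqxx andbT subUset sub1set eEX /= andbCA.
  case: (boolP (A \subset EX)) => //= AEX.
  by rewrite sptreeU1 // (subset_trans AEX).
rewrite -(card_in_imset injS); case: ifP => lk; last first.
  apply/eqP; rewrite cards_eq0; apply/eqP/setP=> A; rewrite inE.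
  apply/imsetP=> -[B BS _]; move: (BS); rewrite inE => /andP[_ eB].
  by move: BS; rewrite -(setD1K eB) SE ?lk // !inE eqxx.
apply: eq_card => A; rewrite inE; apply/imsetP/andP=> [[B BS ->]|[AEX tA]].
  move: (BS); rewrite inE => /andP[_ eB].
  by move: BS; rewrite -{1}(setD1K eB) SE ?lk ?inE ?eqxx // => /andP[_ /andP].
have eA := sptree_jclass1 (subset_trans AEX EXG) tA.
by exists (e |: A); rewrite ?setU1K // SE // lk AEX.
Qed.

(** Pairs (tree, edge of that tree), counted in two ways. *)
Lemma sum_clique_trees :
  \sum_(e in EX | link G psi e)
     #|[set A : {set E} | (A \subset EX) &&
       sptree G (jclass G psi [set e]) A]| =
  #|clique_trees| * #|psi @: D|.-1.
Proof.
rewrite -sum_nat_const big_mkcondr /=.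
rewrite -(eq_bigr _ count_clique_trees_mem).
under eq_bigr => e _ do rewrite -sum1dep_card big_mkcondr /=.
rewrite exchange_big /=; apply: eq_bigr => A;
  rewrite inE => /andP[AEX /andP[_ /eqP->]].
rewrite /= -big_mkcondr /= -sum1_card; apply: eq_bigl => e.
by rewrite andb_idl //; apply: (subsetP AEX).
Qed.

End Label.

(** A form of Cayley's formula for a clique whose vertices are partially
    identified.  Contracting an edge lowers the number of classes by one;
    [sum_clique_trees] and [sum_transversals] show that summing over the edges
    multiplies both sides accordingly, by [m.+1] and [#|X| * m.+1]. *)
Theorem card_clique_trees (L : finType) (psi : V -> L) :
  #|clique_trees psi| * #|X| ^ 2 =
    #|X| ^ #|psi @: D| * #|label_transversals psi|.
Proof.
have X1 : 0 < #|X| by rewrite card_gt0.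
have D1 (L' : finType) (chi : V -> L') : 0 < #|chi @: D|.
  case/set0Pn: X0 => x xX; apply/card_gt0P; exists (chi x).
  by apply/imset_f/(subsetP XG).
move Em: #|psi @: D|.-1 => m.
elim: m L psi Em => [|m IH] L psi Em.
  have b1 : #|psi @: D| = 1 by have := D1 _ psi; lia.
  have -> : clique_trees psi = [set set0].
    apply/setP=> A; rewrite !inE /sptree b1; apply/and3P/eqP=> [[_ _]|->].
      by rewrite eqSS eq_sym cards_eq0 => /eqP.
    by rewrite sub0set nclass0 b1 cards0.
  have -> : label_transversals psi = set1 @: X.
    apply/setP=> R; rewrite inE; apply/idP/imsetP=> [tR|[x xX ->]].
      have /and3P[RX _ _] := tR.
      have cR := card_label_transversal XG tR; rewrite b1 in cR.
      move/eqP/cards1P: cR => [x RE].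
      by exists x; rewrite // -sub1set -RE.
    apply/label_transversalP; split; first by rewrite sub1set.
      by move=> r s; rewrite !inE => /eqP-> /eqP->.
    move=> v vD; exists x; rewrite ?inE //.
    have /eqP/cards1P[c cE] := b1.
    have : psi v \in [set c] by rewrite -cE imset_f.
    have : psi x \in [set c] by rewrite -cE imset_f ?(subsetP XG).
    by rewrite !inE => /eqP-> /eqP->.
  by rewrite cards1 b1 card_imset; [lia | apply: set1_inj].
have bm : #|psi @: D| = m.+2 by lia.
have st e : e \in EX -> link G psi e ->
    #|clique_trees (jclass G psi [set e])| * #|X| ^ 2 =
    #|X| ^ m.+1 * \sum_(y in ends G e) #|[set R in label_transversals psi | y
      \in R]|.
  move=> eEX lk; have eG := subsetP EXG e eEX.
  have c1 : #|jclass G psi [set e] @: D| = m.+1.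
    by move: lk; rewrite /link bm eqSS => /eqP.
  rewrite IH ?c1 //; congr (_ * _).
  have [x [y [xy e_xy xD yD]]] := ends_pairP eG.
  have := EX_ends eEX; rewrite e_xy subUset !sub1set => /andP[xX yX].
  rewrite big_setU1 ?inE //= big_set1.
  rewrite (linkE psi eG e_xy) in lk.
  rewrite /label_transversals (card_transversal_merge XG xX yX lk); last first.
    move=> u v uD vD; rewrite jclass_eq // joined1 // e_xy imsetU1 imset_set1.
    by rewrite !inE.
  by congr (_ + _); apply: eq_card => R; rewrite !inE.
have := sum_clique_trees psi; have := sum_transversals psi; rewrite bm /=.
move: #|label_transversals psi| #|clique_trees psi| => tr ct sumT sumC.
have : ct * m.+1 * #|X| ^ 2 = #|X| ^ m.+1 * (tr * (#|X| * m.+1)).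
  rewrite -sumT -sumC big_distrl big_distrr /=.
  by apply: eq_bigr => e /andP[eEX lk]; apply: st.
move=> H; apply/eqP; rewrite -(eqn_pmul2r (ltn0Sn m)); apply/eqP.
by rewrite mulnAC H (expnSr _ m.+1) -!mulnA (mulnCA tr).
Qed.

End Clique.

(** * Collapsing one clique *)

Section Collapse.
Variables (V E : finType) (G : mgraph V E) (X : {set V}) (EX MX B : {set E}).
Variables (u c : E -> V).
Local Notation D := (vset G).
Hypotheses (XG : X \subset D) (X0 : X != set0).
Hypotheses (EXG : EX \subset eset G) (MXG : MX \subset eset G).
Hypothesis EX_ends : {in EX, forall e, ends G e \subset X}.
Hypothesis EX_simple : {in X &, forall x y, x != y ->
  #|[set e in EX | ends G e == [set x; y]]| = 1}.
Hypothesis MX_ends : {in MX, forall e,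
  [/\ ends G e = [set u e; c e], u e \in X & c e \notin X]}.
Hypothesis MX_inj : {in MX &, injective u}.
Hypotheses (BG : B \subset eset G) (B_ends : {in B, forall e, [disjoint ends G
  e & X]}).

Let H := B :|: MX.

Let HG : H \subset eset G. Proof. by rewrite subUset BG. Qed.

Let B_notX e x : e \in B -> x \in ends G e -> x \notin X.
Proof. by move=> eB xe; rewrite (disjointFr (B_ends eB) xe). Qed.

Let c_ends e : e \in MX -> c e \in ends G e.
Proof. by move=> eM; have [-> _ _] := MX_ends eM; rewrite !inE eqxx orbT. Qed.

Let u_ends e : e \in MX -> u e \in ends G e.
Proof. by move=> eM; have [-> _ _] := MX_ends eM; rewrite !inE eqxx. Qed.

Let dHEX : [disjoint H & EX].
Proof.
apply/pred0P=> e /=; apply/negbTE/negP=> /andP[/setUP[eB|eM] eEX].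
  have /set0Pn[x xe] := ends_neq0 (subsetP BG e eB).
  by have := B_notX eB xe; rewrite (subsetP (EX_ends eEX)).
by have [_ _] := MX_ends eM; rewrite (subsetP (EX_ends eEX)) ?c_ends.
Qed.

Let cardH : #|H| = #|B| + #|MX|.
Proof.
rewrite cardsU (_ : B :&: MX = set0) ?cards0 ?subn0 //.
apply/setP=> e; rewrite !inE; apply/negbTE/negP=> /andP[eB eM].
by have [_ uX _] := MX_ends eM; have := B_notX eB (u_ends eM); rewrite uX.
Qed.

Variables (L L' : finType) (psi : V -> L) (chi : V -> L').
Hypothesis psiX : {in X & D, forall x v, psi x = psi v -> x = v}.
Hypothesis chiE : {in D &, forall v w,
  (chi v == chi w) = (psi v == psi w) || (v \in X) && (w \in X)}.

Let hits (R : {set V}) := [forall v in D, exists r in R, joined G psi H r v].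
(** If [R] meets every class of [H], then [nclass_rank] gives
    [#|psi @: D| <= nclass G psi H + #|H| <= #|R| + #|H|].
       Equality forces [H] to
    be independent and [R] to meet every class only once. *)
Let good (R : {set V}) := (#|R| + #|H| == #|psi @: D|) && hits R.

Let card_good :
  #|[set A : {set E} | (A \subset EX) && sptree G psi (H :|: A)]| * #|X| ^ 2 =
  \sum_(R : {set V} | (R \subset X) && good R) #|X| ^ #|R|.
Proof.
have hitsP (R : {set V}) : R \subset X -> hits R ->
  jclass G psi H @: R = jclass G psi H @: D.
  move=> RX hR; apply/eqP; rewrite eqEsubset imsetS ?(subset_trans RX) //=.
  apply/subsetP=> _ /imsetP[v vD ->];
    have /exists_inP[r rR rv] := forall_inP hR v vD.
  apply/imsetP; exists r; rewrite //; apply/eqP.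
  by rewrite eq_sym jclass_eq // (subsetP XG) // (subsetP RX).
have goodP (R : {set V}) : R \subset X -> good R ->
    #|R| = nclass G psi H /\ #|psi @: D| = nclass G psi H + #|H|.
  move=> RX /andP[/eqP cR hR]; have := nclass_rank psi HG.
  have := leq_imset_card (jclass G psi H) R;
    rewrite hitsP // -/(nclass G psi H); lia.
have [ind|dep] := eqVneq (#|psi @: D|) (nclass G psi H + #|H|); last first.
  rewrite big1 => [|R /andP[RX gR]]; last by case/eqP: dep;
    case: (goodP R RX gR).
  rewrite (_ : [set _ | _] = set0) ?cards0 //; apply/setP=> A; rewrite !inE.
  apply/negbTE/negP=> /andP[AX];
    rewrite sptreeU ?(negPf dep) ?(subset_trans AX) //.
  by rewrite disjoint_sym (disjointWl AX) // disjoint_sym.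
have -> : [set A : {set E} | (A \subset EX) && sptree G psi (H :|: A)] =
          clique_trees G EX (jclass G psi H).
  apply/setP=> A; rewrite !inE; case: (boolP (A \subset EX)) => //= AX.
  rewrite sptreeU ?ind ?eqxx ?(subset_trans AX) //.
  by rewrite disjoint_sym (disjointWl AX) // disjoint_sym.
rewrite (card_clique_trees XG X0 EXG EX_ends EX_simple) -/(nclass G psi H).
rewrite mulnC -sum_nat_const; symmetry; apply: eq_big => [R|R /andP[RX gR]];
  last first.
  by case: (goodP R RX gR) => ->.
rewrite inE; apply/andP/idP=> [[RX gR]|tR].
  have [cR _] := goodP R RX gR; case/andP: gR => _ hR.
  apply/label_transversalP; split=> //.
    by apply/imset_injP; rewrite hitsP // -/(nclass G psi H) cR.
  move=> v vD; have /exists_inP[r rR rv] := forall_inP hR v vD.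
  by exists r; rewrite //; apply/eqP;
    rewrite jclass_eq // (subsetP XG) // (subsetP RX).
have cR := card_label_transversal XG tR;
  case/label_transversalP: tR => RX _ onto; split=> //.
rewrite /good cR ind eqxx; apply/forall_inP=> v vD;
  have [r rR /eqP rv] := onto v vD.
apply/exists_inP; exists r;
  rewrite // -jclass_eq // (subsetP XG) // (subsetP RX) //.
Qed.

(** The transversal encoded by [M']: the vertices of [X] without an edge in [MX],
    which every transversal contains, and the ends of the edges in [M']. *)
Let kept (M' : {set E}) := X :\: u @: (MX :\: M').

Let u_kept (M' : {set E}) e : e \in MX -> (u e \in kept M') = (e \in M').
Proof.
move=> eM; have [_ uX _] := MX_ends eM; rewrite inE uX andbT.
apply/negP/idP=> [uM|eM' /imsetP[f]].
  by apply/negPn/negP=> eM'; apply/uM/imset_f; rewrite inE eM'.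
by rewrite inE => /andP[fM' fM] /(MX_inj eM fM) ef; rewrite -ef eM' in fM'.
Qed.

Let card_kept (M' : {set E}) : M' \subset MX ->
  #|kept M'| + #|MX| = #|X| + #|M'|.
Proof.
move=> M'M; have uX : u @: (MX :\: M') \subset X.
  by apply/subsetP=> _ /imsetP[e /setDP[eM _] ->]; have [] := MX_ends eM.
have := subset_leq_card uX; have := subset_leq_card M'M.
rewrite cardsD (setIidPr uX) card_in_imset; last first.
  by move=> e f /setDP[eM _] /setDP[fM _]; apply: MX_inj.
rewrite cardsD (setIidPr M'M); lia.
Qed.

(** The vertices of [X] outside [kept M'] are pendant for [H]: their only edge
    leads to a vertex outside [X].  Apart from them, being connected to a point
    of [kept M'] by [H] is being connected to the collapsed [X] by [B :|: M'].
      *)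
Let hits_kept (M' : {set E}) : M' \subset MX ->
  hits (kept M') = (nclass G chi (B :|: M') == 1).
Proof.
move=> M'M; have /set0Pn[x0 x0X] := X0; have XD := subsetP XG.
have cD e : e \in MX -> c e \in D.
  by move=> eM; rewrite (subsetP (ends_sub (subsetP MXG e eM))) ?c_ends.
have psiX' v x : v \in D -> x \in X -> psi v = psi x -> v = x.
  by move=> vD xX /esym/psiX->.
rewrite nclass_eq1; apply/forall_inP/andP=> [hR|[_ /forall_inP J] v vD].
  split; first by apply/set0Pn; exists x0; apply: XD.
  pose P v := joined G chi (B :|: M') x0 v.
  have PX x : x \in X -> P x.
    by move=> xX; apply: joined_label; rewrite ?XD //; apply/eqP;
      rewrite chiE ?XD // x0X xX orbT.
  suff PD v : v \in D -> P v.
    apply/forall_inP=> v vD; apply/forall_inP=> w wD.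
    by apply: joined_trans (PD w wD); rewrite joined_sym; apply: PD.
  (* The edge e leads from u e to c e even when it is outside M', so stability
     for H requires P (c e) at the vertex u e. *)
  pose Z := [set v | P v && [forall e in MX, (u e == v) ==> P (c e)]].
  have ZP w : reflect (P w /\ forall e, e \in MX -> u e = w ->
    P (c e)) (w \in Z).
    rewrite inE; apply: (iffP andP) => -[Pw Hw]; split=> //.
      by move=> e eM /eqP uw; move/forall_inP/(_ e eM)/implyP: Hw; apply.
    by apply/forall_inP=> e eM; apply/implyP=> /eqP; apply: Hw.
  have notX w : w \notin X -> P w -> w \in Z.
    move=> wX Pw; apply/ZP; split=> // e eM uw.
    by have [_] := MX_ends eM; rewrite uw (negPf wX).
  have sZ : stable G psi H Z.
    apply/stableP; split=> [w z wD zD wz wZ|e eH w z we ze wZ].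
      have [wX|wX] := boolP (w \in X); first by rewrite -(psiX wX zD wz).
      have [zX|zX] := boolP (z \in X); first by rewrite -(psiX' _ _ wD zX wz).
      apply: notX => //; have /ZP[Pw _] := wZ; apply: joined_trans Pw _.
      by apply: joined_label => //; apply/eqP; rewrite chiE // wz eqxx.
    case/setUP: eH => [eB|eM].
      apply: notX; first exact: B_notX eB ze.
      have /ZP[Pw _] := wZ; apply: joined_trans Pw _.
      by apply: joined_edge we ze; rewrite inE eB.
    have [exy uX cX] := MX_ends eM.
    have /ZP[Pw Qw] := wZ; move: we ze Pw Qw; rewrite exy !in_set2.
    case/pred2P=> -> /pred2P[] -> Pw Qw; try by apply/ZP.
      by apply: notX => //; apply: Qw.
    by apply/ZP; split=> [|f fM /(MX_inj fM eM)->] //; apply: PX.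
  move=> vD; have /exists_inP[r rR /joinedP/(_ Z sZ) rv] := hR v vD.
  suff rZ : r \in Z by rewrite rZ in rv; have /ZP[] := esym rv.
  have rX : r \in X by case/setDP: rR.
  apply/ZP; split=> [|e eM ur]; first exact: PX.
  have eM' : e \in M' by rewrite -u_kept // ur.
  apply: joined_trans (PX r rX) _; rewrite -ur.
  by apply: joined_edge (u_ends eM) (c_ends eM); rewrite inE eM' orbT.
pose S v := [exists r in kept M', joined G psi H r v].
have Sstep w z : joined G psi H w z -> S w -> S z.
  move=> wz /exists_inP[r rR rw]; apply/exists_inP; exists r => //.
  exact: joined_trans rw wz.
have edgeH e w z : e \in H -> w \in ends G e -> z \in ends G e -> S w -> S z.
  by move=> eH we ze; apply: Sstep; apply: joined_edge we ze.
have Sin r : r \in kept M' -> S r.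
  by move=> rR; apply/exists_inP; exists r; rewrite ?joined_refl.
(* A path towards the collapsed X ends with an edge of M', hence at a point
   of kept M'; before that edge it only uses edges of B. *)
have sZ : stable G chi (B :|: M') [set w | (w \in X) || S w].
  apply/stableP; split=> [w z wD zD /eqP|e eBM w z we ze]; rewrite !inE.
    rewrite chiE //; case/orP=> [/eqP wz|/andP[_ ->]] //.
    have [wX|wX] := boolP (w \in X); first by rewrite -(psiX wX zD wz) wX.
    by move=> /= Sw; apply/orP; right; apply: Sstep Sw; apply: joined_label.
  case/setUP: eBM => [eB|eM'].
    rewrite (negPf (B_notX eB we)) /= => Sw; apply/orP; right.
    by apply: edgeH we ze Sw; rewrite inE eB.
  have eM := subsetP M'M e eM'; have [exy uX cX] := MX_ends eM => _.
  move: ze; rewrite exy !inE => /pred2P[] ->; first by rewrite uX.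
  apply/orP; right; apply: edgeH (u_ends eM) (c_ends eM) (Sin _ _).
    by rewrite inE eM orbT.
  by rewrite u_kept.
have XS w : w \in D -> w \notin X -> S w.
  move=> wD wX; have /joinedP/(_ _ sZ) := forall_inP (J x0 (XD _ x0X)) w wD.
  by rewrite !inE x0X (negPf wX) /= => <-.
have [vX|vX] := boolP (v \in X); last exact: XS.
have [vR|] := boolP (v \in kept M'); first exact: Sin.
rewrite inE vX andbT negbK => /imsetP[e /setDP[eM _] ve].
have [_ _ cX] := MX_ends eM; rewrite ve.
by apply: edgeH (c_ends eM) (u_ends eM) (XS _ (cD e eM) cX);
  rewrite inE eM orbT.
Qed.

Let good_kept (M' : {set E}) : M' \subset MX ->
  good (kept M') = sptree G chi (B :|: M').
Proof.
move=> M'M; rewrite /good hits_kept // /sptree andbC; congr (_ && _).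
have dBM : B :&: M' = set0.
  apply/setP=> e; rewrite !inE; apply/negbTE/negP=> /andP[eB /(subsetP M'M) eM].
  by have [_ uX _] := MX_ends eM; have := B_notX eB (u_ends eM); rewrite uX.
have cX : #|psi @: X| = #|X|.
  by apply: card_in_imset => x y xX yX; apply: psiX; rewrite ?(subsetP XG).
have memX v : v \in D -> (psi v \in psi @: X) = (v \in X).
  move=> vD; apply/imsetP/idP=> [[x xX /esym/psiX<-]|vX] //; by exists v.
have := @card_imset_collapse _ _ _ D X psi chi X0 XG; rewrite cX.
have sX : {in D &, forall v w, (chi v == chi w) =
    (psi v == psi w) || (psi v \in psi @: X) && (psi w \in psi @: X)}.
  by move=> v w vD wD; rewrite !memX // chiE.
move/(_ sX); have := card_kept M'M; rewrite cardH cardsU dBM cards0; lia.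
Qed.

(** The transversals counted in [card_good] are exactly the sets [kept M']. *)
Lemma clique_collapse :
  #|[set A : {set E} | (A \subset EX) && sptree G psi (B :|: MX :|: A)]|
     * #|X| ^ (2 + #|MX|) =
  \sum_(M' : {set E} | (M' \subset MX) && sptree G chi (B :|: M'))
     #|X| ^ (#|X| + #|M'|).
Proof.
rewrite expnD mulnA card_good big_distrl /=.
(* A transversal R comes from the edges of MX with their end u e in R: it contains
   the vertices of X that are isolated in H, which have no edge to be joined
     by. *)
rewrite (reindex_onto kept (fun R => [set e in MX | u e \in R])) /=; last first.
  move=> R /andP[RX /andP[_ hR]]; apply/setP=> x; rewrite inE.
  have [xX|xX] := boolP (x \in X); last first.
    by rewrite andbF; apply/esym/negbTE; apply: contra xX; apply: (subsetP RX).
  rewrite andbT; apply/negP/idP=> [xu|xR /imsetP[e]]; last first.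
    by rewrite !inE => /andP[+ eM] xue; rewrite eM -xue xR.
  have [//|xR] := boolP (x \in R).
  have /exists_inP[r rR rx] := forall_inP hR x (subsetP XG x xX).
  suff sx : stable G psi H [set x].
    by have := joinedP _ _ _ _ _ rx _ sx; rewrite !inE eqxx => /eqP rE;
      rewrite -rE rR in xR.
  apply/stableP; split=> [v w vD wD vw|e eH v w ve we]; rewrite !inE => /eqP vx.
    by rewrite vx in vw; rewrite (psiX xX wD vw).
  rewrite vx in ve; case/setUP: eH => [eB|eM].
    by have := B_notX eB ve; rewrite xX.
  have [exy uX cX] := MX_ends eM; move: ve; rewrite exy !inE.
  case/orP=> [/eqP xe|/eqP xc]; last by rewrite -xc xX in cX.
  by case: xu; apply/imsetP; exists e; rewrite // !inE eM -xe xR.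
apply: eq_big => [M'|M' /andP[_ /eqP M'E]]; last first.
  rewrite -!expnD; congr (_ ^ _); apply: card_kept.
  by rewrite -M'E; apply/subsetP=> e; rewrite inE => /andP[].
have -> : ([set e in MX | u e \in kept M'] == M') = (M' \subset MX).
  rewrite [RHS](sameP setIidPr eqP); congr (_ == _); apply/setP=> e;
    rewrite in_setI [LHS]in_set.
  by case: (boolP (e \in MX)) => //= eM; rewrite u_kept.
rewrite subsetDl andbC /=; case: (boolP (M' \subset MX)) => //= M'M.
exact: good_kept.
Qed.

End Collapse.

(** * Collapsing all the cliques *)

Lemma sptree_ker (V E L L' : finType) (G : mgraph V E) (psi : V ->
  L) (chi : V -> L') A :
  {in vset G &, forall u v, (psi u == psi v) = (chi u == chi v)} ->
  sptree G psi A = sptree G chi A.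
Proof.
move=> ker; have stE Z : stable G psi A Z = stable G chi A Z.
  apply/stableP/stableP=> -[HV HE]; split=> // u v uD vD /eqP uv;
    apply: HV => //;
  by apply/eqP; rewrite ?ker // -ker.
rewrite /sptree (card_imset_ker ker); congr ((_ == _) && _).
apply: card_imset_ker => u v uD vD; rewrite !jclass_eq //.
by apply: eq_forallb => Z; rewrite stE.
Qed.

Section Assembly.
Variables (V E : finType) (G : mgraph V E) (k : nat).
Variables (V0 : {set V}) (Vs : 'I_k -> {set V}) (N : {set E}).
Local Notation D := (vset G).
Local Notation Mi i := (edges_between G (Vs i) V0).
Local Notation Ei i := (eset (induced G (Vs i))).
Local Notation M := (\bigcup_(i < k) Mi i).
Local Notation U := (\bigcup_(i < k) Vs i).
Hypothesis V_part : partition (V0 |: [set Vs i | i : 'I_k]) D.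
Hypothesis Vs_inj : injective Vs.
Hypothesis Vs_V0 : forall i, Vs i != V0.
Hypothesis Vs_clique : forall i, clique G (Vs i).
Hypothesis Vs_sep :
  forall i j : 'I_k, i < j -> edges_between G (Vs i) (Vs j) = set0.
Hypothesis M_stars : forall C : {set V}, C \in components (edge_induced G M) ->
  exists2 c, c \in V0 & star_with_center (induced (edge_induced G M) C) c.
Hypothesis NV0 : N \subset eset (induced G V0).

Let parts := V0 |: [set Vs i | i : 'I_k].
Let Vs_parts i : Vs i \in parts. Proof. by rewrite !inE imset_f ?orbT. Qed.
Let V0_parts : V0 \in parts. Proof. by rewrite !inE eqxx. Qed.

Let Vs_D i : Vs i \subset D.
Proof.
have /and3P[/eqP <- _ _] := V_part; exact: bigcup_sup (Vs_parts i).
Qed.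

Let Vs_neq0 i : Vs i != set0.
Proof. by have /and3P[_ _] := V_part; apply: contraNneq => <-. Qed.

Let parts_disj A B x : A \in parts -> B \in parts -> x \in A -> x \in B ->
  A = B.
Proof.
move=> AP BP xA xB; have /and3P[_ tI _] := V_part.
by rewrite -(def_pblock tI AP xA) (def_pblock tI BP xB).
Qed.

Let Vs_disj i j x : x \in Vs i -> x \in Vs j -> i = j.
Proof. by move=> xi xj; apply/Vs_inj/(parts_disj (Vs_parts i) (Vs_parts j) xi
  xj). Qed.

Let Vs_notV0 i x : x \in Vs i -> x \notin V0.
Proof.
move=> xi; apply/negP=> x0; case/eqP: (Vs_V0 i).
exact: parts_disj (Vs_parts i) V0_parts xi x0.
Qed.

Let D_cases x : x \in D -> x \in V0 \/ exists i, x \in Vs i.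
Proof.
have /and3P[/eqP <- _ _] := V_part => /bigcupP[A]; rewrite !inE.
by case/predU1P=> [->|/imsetP[i _ ->]]; [left | right; exists i].
Qed.

Let EiP i e : reflect (e \in eset G /\ ends G e \subset Vs i) (e \in Ei i).
Proof. by rewrite inE; apply: andP. Qed.

Let MiP i e : reflect (exists x y,
    [/\ e \in eset G, ends G e = [set x;
      y], x \in Vs i & y \in V0]) (e \in Mi i).
Proof.
rewrite inE; apply: (iffP andP) =>
  [[eG /exists_inP[x xi /exists_inP[y y0 /eqP exy]]]|].
  by exists x, y.
case=> x [y [eG exy xi y0]]; split=> //; apply/exists_inP; exists x => //.
by apply/exists_inP; exists y; rewrite ?exy.
Qed.

Let EiG i : Ei i \subset eset G.
Proof. by apply/subsetP=> e /EiP[]. Qed.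

Let MiG i : Mi i \subset eset G.
Proof. by apply/subsetP=> e /MiP[x [y []]]. Qed.

(** Besides [M], no edge leaves a clique: this is where the separation of the
    cliques is used. *)
Let touch i e x : e \in eset G -> x \in ends G e -> x \in Vs i ->
  (e \in Ei i) || (e \in Mi i).
Proof.
move=> eG xe xi; have [a [b [ab e_ab _ _]]] := ends_pairP eG.
have [y [exy yD]] : exists y, ends G e = [set x; y] /\ y \in D.
  move: xe; rewrite e_ab !inE => /pred2P[->|->]; [exists b | exists a;
    rewrite setUC];
  by split=> //; apply: (subsetP (ends_sub eG)); rewrite e_ab !inE eqxx ?orbT.
case: (D_cases yD) => [y0|[j yj]].
  by apply/orP; right; apply/MiP; exists x, y.
have [ij|ij|/val_inj ij] := ltngtP i j.
- suff : e \in edges_between G (Vs i) (Vs j) by rewrite Vs_sep // inE.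
  rewrite inE eG; apply/exists_inP; exists x => //.
  by apply/exists_inP; exists y; rewrite ?exy.
- suff : e \in edges_between G (Vs j) (Vs i) by rewrite Vs_sep // inE.
  rewrite inE eG; apply/exists_inP; exists y => //.
  by apply/exists_inP; exists x; rewrite ?exy // setUC.
apply/orP; left; apply/EiP; split=> //; rewrite exy subUset !sub1set xi.
by rewrite ij.
Qed.

Let Mi_end i e : e \in Mi i -> exists2 x, x \in ends G e & x \in Vs i.
Proof. by case/MiP=> x [y [_ -> xi _]]; exists x; rewrite ?inE ?eqxx. Qed.

Let Mi_end0 i e : e \in Mi i -> exists2 x, x \in ends G e & x \in V0.
Proof. by case/MiP=> x [y [_ -> _ y0]]; exists y; rewrite ?inE ?eqxx ?orbT. Qed.

Let Ei_end i e : e \in Ei i -> exists2 x, x \in ends G e & x \in Vs i.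
Proof.
case/EiP=> eG /subsetP ei; have /set0Pn[x xe] := ends_neq0 eG.
by exists x; rewrite ?ei.
Qed.

Let dEE i j e : e \in Ei i -> e \in Ei j -> i = j.
Proof.
move=> /Ei_end[x xe xi] /EiP[_ /subsetP ej]; exact: Vs_disj xi (ej x xe).
Qed.

Let dEM i j e : e \in Ei i -> e \notin Mi j.
Proof.
case/EiP=> _ /subsetP ei; apply/negP=> /Mi_end0[x xe].
by rewrite (negPf (Vs_notV0 (ei x xe))).
Qed.

Let dMM i j e : e \in Mi i -> e \in Mi j -> i = j.
Proof.
case/Mi_end=> x xe xi /MiP[y [z [_ exy yj z0]]].
move: xe; rewrite exy !inE => /pred2P[xy|xz]; first by apply: Vs_disj xi _;
  rewrite xy.
by have := Vs_notV0 xi; rewrite xz z0.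
Qed.

Let NE i e : e \in N -> e \notin Ei i.
Proof.
move/(subsetP NV0); rewrite inE => /andP[eG /subsetP e0];
  apply/negP=> /Ei_end[x xe].
by move/Vs_notV0; rewrite e0.
Qed.

Let NM i e : e \in N -> e \notin Mi i.
Proof.
move/(subsetP NV0); rewrite inE => /andP[eG /subsetP e0];
  apply/negP=> /Mi_end[x xe].
by move/Vs_notV0; rewrite e0.
Qed.

Let Vs_simple i : {in Vs i &, forall x y, x != y ->
  #|[set e in Ei i | ends G e == [set x; y]]| = 1}.
Proof.
move=> x y xi yi xy; have /andP[_ /forall_inP cl] := Vs_clique i.
have xD : x \in vset (induced G (Vs i)) by rewrite inE xi (subsetP (Vs_D i)).
have yD : y \in vset (induced G (Vs i)) by rewrite inE yi (subsetP (Vs_D i)).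
by move/forall_inP/(_ y yD)/implyP/(_ xy)/eqP: (cl x xD).
Qed.

(** Two edges of [M] at [x] lie in the same component, a star whose center is
    in [V0], hence different from [x]; so both join [x] to that center. *)
Let M_unique i x e f : x \in Vs i -> e \in M -> f \in M ->
  x \in ends G e -> x \in ends G f -> e = f.
Proof.
move=> xi eM fM xe xf; set H := edge_induced G M.
have MG : M \subset eset G by apply/bigcupsP=> j _; apply: MiG.
have eH : eset H = M by apply/setIidPr.
have inH g : g \in M -> ends G g \subset vset H.
  by move=> gM; apply: (ends_sub (m := H)); rewrite eH.
have /and3P[/eqP cov tI _] := components_partition H.
have xH : x \in vset H := subsetP (inH e eM) x xe.
have CP : pblock (components H) x \in components H by rewrite pblock_mem ?cov.
have [c c0 /and3P[_ /forall_inP cends /forall_inP c1]] := M_stars CP.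
have endsC g : g \in M -> x \in ends G g ->
    g \in eset (induced H (pblock (components H) x)).
  move=> gM xg; rewrite inE eH gM; apply/subsetP=> y yg.
  have yH := subsetP (inH g gM) y yg.
  rewrite (pblock_equivalence_partition (@connect_adjacent_equiv _ _ H (vset
    H))) //.
  rewrite -joined_connect; by apply: (@joined_edge _ _ H _ id (eset H) g);
    rewrite ?eH.
have xc : x != c by apply: contraNneq (Vs_notV0 xi) => ->.
have xS : x \in vset (induced H (pblock (components H) x)) :\ c.
  by rewrite !inE xc mem_pblock cov !xH.
have [g gE] := cards1P (c1 x xS).
have uniq h : h \in M -> x \in ends G h -> h = g.
  move=> hM xh; apply/set1P; rewrite -gE inE endsC //=.
  have hG := subsetP MG h hM.
  rewrite eq_sym eqEcard cards2 eq_sym xc (ends_card hG) andbT.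
  by apply/subsetP=> z; rewrite !inE => /pred2P[] -> //; apply: cends;
    apply: endsC.
by rewrite (uniq e) // (uniq f).
Qed.

(** The vertex obtained from [v] when the first [j] cliques are collapsed. *)
Definition merged (j : nat) (v : V) : {set V} :=
  [set w | (w == v) || [exists i : 'I_k, [&& i < j, v \in Vs i & w \in Vs i]]].

Let merged_in j v (i : 'I_k) : i < j -> v \in Vs i -> merged j v = Vs i.
Proof.
move=> ij vi; apply/setP=> z; rewrite inE; apply/orP/idP=> [[/eqP-> //|]|zi].
  by case/existsP=> i' /and3P[_ wi' zi']; rewrite (Vs_disj vi wi').
by right; apply/existsP; exists i; rewrite ij vi zi.
Qed.

Let mergedE j u v : (merged j u == merged j v) =
  (u == v) || [exists i : 'I_k, [&& i < j, u \in Vs i & v \in Vs i]].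
Proof.
apply/eqP/idP=> [/setP/(_ v)|]; first by rewrite !inE eqxx orTb eq_sym => ->.
case/predU1P=> [-> //|/existsP[i /and3P[ij ui vi]]].
by rewrite !(merged_in ij).
Qed.

Let merged_step (j : 'I_k) : {in D &, forall v w,
  (merged j.+1 v == merged j.+1 w) =
  (merged j v == merged j w) || (v \in Vs j) && (w \in Vs j)}.
Proof.
move=> v w _ _; rewrite !mergedE -orbA; congr (_ || _).
apply/existsP/orP=> [[i /and3P[]]|[/existsP[i /and3P[ij vi wi]]|/andP[vj wj]]].
- rewrite ltnS leq_eqVlt => /predU1P[/val_inj-> -> ->|ij vi wi]; first by right.
  by left; apply/existsP; exists i; rewrite ij vi.
- by exists i; rewrite ltnW // ?vi ?wi //.
by exists j; rewrite ltnSn vj.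
Qed.

Let merged_fresh (j : 'I_k) :
  {in Vs j & D, forall x v, merged j x = merged j v -> x = v}.
Proof.
move=> x v xj _ /eqP; rewrite mergedE =>
  /predU1P[//|/existsP[i /and3P[ij xi _]]].
by rewrite (Vs_disj xi xj) ltnn in ij.
Qed.

(** The edge sets of the spanning trees of the graph in which the first [j]
    cliques are collapsed.  For these cliques any part of [M] may occur, as in
    the contraction; for the others all of it is required, as in [G]. *)
Definition hybrid (j : nat) (T : {set E}) : bool :=
  [&& T \subset eset G, N \subset T,
      [forall i : 'I_k, if i < j then [disjoint T & Ei i] else Mi i \subset T]
    & sptree G (merged j) T].

(** The weights by which [clique_collapse] replaces a collapsed clique. *)
Definition hybrid_weight (j : nat) (T : {set E}) : nat :=
  \prod_(i < k | i < j) #|Vs i| ^ (#|Vs i| + #|T :&: Mi i|).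

Definition hybrid_sum (j : nat) : nat :=
  \sum_(T | hybrid j T) hybrid_weight j T.

Section Step.
Variable j : 'I_k.
Let K := Mi j :|: Ei j.

Let rest (B : {set E}) : bool :=
  [&& B \subset eset G :\: K, N \subset B &
      [forall i : 'I_k, (i != j) ==>
         (if i < j then [disjoint B & Ei i] else Mi i \subset B)]].

Let notKE i e : i != j -> e \in Ei i -> e \notin K.
Proof.
move=> ij ei; rewrite inE negb_or (dEM _ ei); apply: contra ij => ej.
by rewrite (dEE ei ej).
Qed.

Let notKM i e : i != j -> e \in Mi i -> e \notin K.
Proof.
move=> ij ei; rewrite inE negb_or; apply/andP; split.
  by apply: contra ij => ej; rewrite (dMM ei ej).
by apply: contraL ei; apply: dEM.
Qed.

Let notKN e : e \in N -> e \notin K.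
Proof. by move=> eN; rewrite inE negb_or NE ?NM. Qed.

Let rest_trace (m : nat) (T : {set E}) : (m == j :> nat) || (m == j.+1) ->
  hybrid m T -> rest (T :\: K).
Proof.
move=> mj /and4P[TG NT /forallP HT _]; apply/and3P; split.
- exact: setSD.
- by apply/subsetP=> e eN; rewrite inE (subsetP NT) ?notKN.
apply/forallP=> i; apply/implyP=> ij; have := HT i.
have -> : (i < m) = (i < j).
  case/pred2P: mj => -> //; rewrite ltnS leq_eqVlt;
    case: eqP => // /val_inj ij'.
  by rewrite ij' eqxx in ij.
case: ifP => _; first exact: disjointWl (subsetDl _ _).
move/subsetP=> MT; apply/subsetP=> e eM; rewrite inE MT // (notKM ij) //.
Qed.

Let hybridE (m : nat) (B C : {set E}) : (m == j :> nat) || (m == j.+1) ->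
  rest B -> C \subset K ->
  hybrid m (B :|: C) =
  (if m == j :> nat then Mi j \subset C else [disjoint C & Ei j]) &&
  sptree G (merged m) (B :|: C).
Proof.
move=> mj /and3P[BG NB /forallP HB] CK.
have BK e : e \in B -> e \notin K by move/(subsetP BG); rewrite inE => /andP[].
rewrite /hybrid (subset_trans NB (subsetUl _ _)) /= subUset.
rewrite (subset_trans BG (subsetDl _ _)) (subset_trans CK) /=; last first.
  by rewrite subUset MiG EiG.
congr (_ && _); apply/forallP/idP=> [/(_ j)|jC i].
  case/pred2P: mj => ->; rewrite ?ltnn ?ltnSn ?eqxx; last first.
    rewrite (_ : (j.+1 == j :> nat) = false); last by apply/eqP; lia.
    exact: disjointWl (subsetUr _ _).
  move/subsetP=> MT; apply/subsetP=> e eM; have := MT e eM; rewrite inE.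
  by case/orP=> // /BK; rewrite inE eM.
have [->|ij] := eqVneq i j.
  case/pred2P: mj jC => ->; rewrite ?ltnn ?ltnSn ?eqxx.
    by move=> MC; apply: subset_trans MC (subsetUr _ _).
  rewrite (_ : (j.+1 == j :> nat) = false); last by apply/eqP; lia.
  move=> CE; rewrite -setI_eq0 setIUl; apply/eqP/setP=> e; rewrite !inE.
  have /pred0P/(_ e) /= := CE; rewrite !inE => ->; rewrite orbF.
  apply/negbTE/negP=> /andP[/BK]; rewrite inE negb_or => /andP[_ +] eE.
  by rewrite inE eE.
have := implyP (HB i) ij.
have -> : (i < m) = (i < j).
  case/pred2P: mj => -> //; rewrite ltnS leq_eqVlt;
    case: eqP => // /val_inj ij'.
  by rewrite ij' eqxx in ij.
case: ifP => _ HBi; last exact: subset_trans HBi (subsetUl _ _).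
apply/pred0P=> e /=; apply/negbTE/negP=> /andP[/setUP[eB|eC] eE].
  by rewrite (disjointFr HBi eB) in eE.
by have := notKE ij eE; rewrite (subsetP CK e eC).
Qed.

Let rest_notK B e : rest B -> e \in B -> e \notin K.
Proof. by case/and3P=> /subsetP BG _ _ /BG; rewrite inE => /andP[]. Qed.

Let hybrid_sumE (m : nat) : (m == j :> nat) || (m == j.+1) ->
  hybrid_sum m =
  \sum_(B | rest B) \sum_(C : {set E} | [&& C \subset K,
      if m == j :> nat then Mi j \subset C else [disjoint C & Ei j]
      & sptree G (merged m) (B :|: C)]) hybrid_weight m (B :|: C).
Proof.
move=> mj; rewrite /hybrid_sum (partition_big (fun T => T :\: K) rest);
  last first.
  by move=> T; apply: rest_trace.
apply: eq_bigr => B rB.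
rewrite (reindex_onto (fun C => B :|: C) (fun T => T :&: K)); last first.
  by move=> T /andP[_ /eqP <-]; rewrite setUC setID.
apply: eq_bigl => C; apply/idP/idP=> [/andP[/andP[hBC _] /eqP CE]|].
  have CK : C \subset K by rewrite -CE subsetIr.
  by rewrite CK /= -hybridE.
case/andP=> CK; rewrite -hybridE // => ->; rewrite /=; apply/andP; split.
  apply/eqP/setP=> e; rewrite in_setD in_setU; case: (boolP (e \in B)) => eB /=.
    by rewrite (rest_notK rB eB).
  by case: (boolP (e \in C)) => eC; rewrite ?andbF // (subsetP CK e eC).
apply/eqP/setP=> e; rewrite in_setI in_setU; case: (boolP (e \in C)) => eC.
  by rewrite orbT (subsetP CK e eC).
by rewrite orbF; apply/negbTE/negP=> /andP[/(rest_notK rB)/negP].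
Qed.

(** Both sides are grouped according to the part [B] of the tree formed by the
    edges that do not meet the clique [Vs j]. *)
Lemma hybrid_step : hybrid_sum j.+1 = #|Vs j| ^ (2 + #|Mi j|) * hybrid_sum j.
Proof.
rewrite !hybrid_sumE ?eqxx ?orbT // (_ : (j.+1 == j :> nat) = false);
  last first.
  by apply/eqP; lia.
rewrite big_distrr /=; apply: eq_bigr => B rB.
have /and3P[BGK _ _] := rB; have BG := subset_trans BGK (subsetDl _ _).
have wI i (C : {set E}) : i != j -> C \subset K ->
  (B :|: C) :&: Mi i = B :&: Mi i.
  move=> ij /subsetP CK; apply/setP=> e; rewrite !in_setI in_setU.
  case: (boolP (e \in Mi i)) => [eM|]; rewrite ?andbF // !andbT.
  by case: (boolP (e \in C)) => [/CK|]; rewrite ?orbF // (negPf (notKM ij eM)).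
rewrite [in LHS](eq_bigr (fun C : {set E} =>
  hybrid_weight j B * #|Vs j| ^ (#|Vs j| + #|C|))); last first.
  move=> C /and3P[CK CE _]; rewrite /hybrid_weight (bigD1 j) //= mulnC;
    congr (_ * _).
    apply: eq_big => [i|i /andP[_ ij]]; last by rewrite wI.
    by rewrite ltnS leq_eqVlt; case: (eqVneq i j) => [->|ij];
      rewrite ?ltnn ?eqxx // andbT;
       case: eqP => // /val_inj ij'; rewrite ij' eqxx in ij.
  congr (_ ^ (_ + #|pred_of_set _|)); apply/setP=> e; rewrite in_setI in_setU.
  case: (boolP (e \in C)) => [eC|eC] /=.
    rewrite orbT /=; have := subsetP CK e eC; rewrite in_setU => /orP[//|eE].
    by rewrite (disjointFr CE eC) in eE.
  rewrite orbF; apply/negbTE/negP=> /andP[/(rest_notK rB)].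
  by rewrite in_setU negb_or => /andP[/negbTE->].
rewrite [in RHS](eq_bigr (fun C : {set E} => hybrid_weight j B)); last first.
  move=> C /and3P[CK _ _]; apply: eq_bigr => i ij; rewrite wI //.
  by apply: contraTneq ij => ->; rewrite ltnn.
rewrite -big_distrr /= sum_nat_const mulnA [RHS]mulnC; congr (_ * _).
have /set0Pn[x0 x0j] := Vs_neq0 j.
(* An edge of Mi j has exactly one end in Vs j; the default x0 is never taken. *)
pose u e := odflt x0 [pick x in ends G e :&: Vs j].
pose c e := odflt x0 [pick x in ends G e :\: Vs j].
have uc : {in Mi j, forall e, [/\ ends G e = [set u e;
  c e], u e \in Vs j & c e \notin Vs j]}.
  move=> e /MiP[x [y [_ exy xj y0]]].
  have yj : y \notin Vs j by apply: contraL y0; apply: Vs_notV0.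
  have -> : u e = x.
    rewrite /u; case: pickP => [z|/(_ x)] /=; rewrite exy !inE ?eqxx ?xj //.
    by case/andP=> /pred2P[-> //|->]; rewrite (negPf yj).
  have -> : c e = y.
    rewrite /c; case: pickP => [z|/(_ y)] /=;
      rewrite exy !inE ?eqxx ?orbT ?yj //.
    by case/andP=> zj /pred2P[zx|//]; rewrite zx xj in zj.
  by [].
have u_inj : {in Mi j &, injective u}.
  move=> e f eM fM ef; have [exy uj _] := uc e eM; have [fxy _ _] := uc f fM.
  apply: (M_unique uj); try by apply/bigcupP; exists j.
    by rewrite exy !inE eqxx.
  by rewrite fxy ef !inE eqxx.
have Bj : {in B, forall e, [disjoint ends G e & Vs j]}.
  move=> e eB; apply/pred0P=> x /=; apply/negbTE/negP=> /andP[xe xj].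
  have := touch (subsetP BG e eB) xe xj; have := rest_notK rB eB.
  by rewrite in_setU orbC => /negbTE->.
have := @clique_collapse _ _ G (Vs j) (Ei j) (Mi j) B u c (Vs_D j) (Vs_neq0 j)
  (EiG j) (MiG j) _ (@Vs_simple j) uc u_inj BG Bj _ _ (merged j) (merged j.+1)
  (@merged_fresh j) (@merged_step j).
have Eends : {in Ei j, forall e, ends G e \subset Vs j} by move=> e /EiP[].
move/(_ Eends) => cc.
transitivity (\sum_(M' : {set E} | (M' \subset Mi j) &&
  sptree G (merged j.+1) (B :|: M'))
     #|Vs j| ^ (#|Vs j| + #|M'|)).
  apply: eq_bigl => C; rewrite andbA; congr (_ && _).
  apply/andP/idP=> [[/subsetP CK CE]|/subsetP CM].
    apply/subsetP=> e eC; have := CK e eC;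
      rewrite in_setU (disjointFr CE eC) orbF //.
  split; first by apply/subsetP=> e /CM; rewrite in_setU => ->.
  by apply/pred0P=> e /=; apply/negbTE/negP=> /andP[/CM eM /dEM]; move/(_ j);
    rewrite eM.
rewrite -cc mulnC; congr (_ * _).
have injM : {in [set A : {set E} | (A \subset Ei j) &&
  sptree G (merged j) (B :|: Mi j :|: A)] &,
     injective (fun A => Mi j :|: A)}.
  move=> A A'; rewrite !inE =>
    /andP[/subsetP AE _] /andP[/subsetP AE' _] /setP AA.
  apply/setP=> e; have := AA e; rewrite !in_setU.
  case: (boolP (e \in Mi j)) => // eM _.
  have /negbTE eE : e \notin Ei j by apply: contraL eM; apply: dEM.
  by apply/idP/idP=> [/AE|/AE']; rewrite eE.
rewrite -(card_in_imset injM); apply: eq_card => C; rewrite [RHS]inE.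
apply/imsetP/and3P=> [[A + ->]|[CK MC tC]].
  rewrite inE -setUA => /andP[AE ->]; rewrite subsetUl subUset subsetUl;
    split=> //.
  exact: subset_trans AE (subsetUr _ _).
have CE : Mi j :|: C :\: Mi j =
  C by rewrite -[RHS](setID C (Mi j)) (setIidPr MC).
exists (C :\: Mi j); last by rewrite CE.
by rewrite inE -setUA CE tC andbT subDset.
Qed.

End Step.

Lemma hybrid_sum_prod :
  hybrid_sum k = (\prod_(i < k) #|Vs i| ^ (2 + #|Mi i|)) * hybrid_sum 0.
Proof.
have step (j : nat) : j <= k ->
    hybrid_sum j = (\prod_(i < k | i < j) #|Vs i| ^ (2 + #|Mi i|)) * hybrid_sum
      0.
  elim: j => [|j IH] jk; first by rewrite big_pred0 ?mul1n.
  rewrite (hybrid_step (Ordinal jk)) /= IH ?(ltnW jk) // mulnA; congr (_ * _).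
  rewrite [RHS](bigD1 (Ordinal jk)) //=; congr (_ * _); apply: eq_bigl => i.
  by rewrite -val_eqE /=; lia.
by rewrite step //; congr (_ * _); apply: eq_bigl => i; rewrite ltn_ord.
Qed.

Lemma hybrid_sum0 : hybrid_sum 0 = tau G (M :|: N).
Proof.
rewrite /hybrid_sum /tau -sum1_card; apply: eq_big => [T|T _]; last first.
  by rewrite /hybrid_weight big_pred0.
rewrite inE /hybrid; case: (boolP (T \subset eset G)) => //= TG.
rewrite tree_sptree // (sptree_ker (psi := merged 0) (chi := id)); last first.
  move=> v w _ _; rewrite mergedE; case: eqP => //= _.
  by apply/existsP=> -[i].
rewrite andbA andbC; congr (_ && _); rewrite subUset andbC; congr (_ && _).
by apply/forallP/bigcupsP=> H i; have := H i => // /(_ isT).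
Qed.

Let EU e : e \in eset G -> ends G e \subset U -> exists i, e \in Ei i.
Proof.
move=> eG eU; have /set0Pn[x xe] := ends_neq0 eG.
have /bigcupP[i _ xi] := subsetP eU x xe; exists i.
case/orP: (touch eG xe xi) => // /Mi_end0[y ye y0].
have /bigcupP[i' _ yi'] := subsetP eU y ye.
by have := Vs_notV0 yi'; rewrite y0.
Qed.

Let EiU i e : e \in Ei i -> e \in eset (induced G U).
Proof.
case/EiP=> eG ei; rewrite inE eG; apply: subset_trans ei _.
exact: (bigcup_sup i).
Qed.

(** A clique is connected by its own edges, and an edge inside [U] lies in one
    clique; so the vertices of the contraction are the cliques and the
    singletons. *)
Let pblock_merged v : v \in D -> pblock (contract_vset G U) v = merged k v.
Proof.
move=> vD; set S := spanning G (eset (induced G U)).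
have /and3P[/eqP cov tI _] := contract_vset_partition G U.
have mD : merged k v \subset D.
  apply/subsetP=> w; rewrite inE => /predU1P[->//|/existsP[i /and3P[_ _ wi]]].
  exact: subsetP (Vs_D i) w wi.
have pD : pblock (contract_vset G U) v \subset cover (contract_vset G U).
  apply/subsetP=> w wv; apply/bigcupP;
    exists (pblock (contract_vset G U) v) => //.
  by rewrite pblock_mem ?cov.
rewrite cov in pD.
apply/setP=> w; have [wD|wD] := boolP (w \in D); last first.
  by apply/idP/idP=> [/(subsetP pD)|/(subsetP mD)]; rewrite (negPf wD).
rewrite /contract_vset /components -/S.
rewrite (pblock_equivalence_partition (@connect_adjacent_equiv _ _ S D)) //.
apply/idP/idP=> [vw|].
  have vv : v \in merged k v by rewrite inE eqxx.
  rewrite -(closed_connect _ vw) // => x y /existsP[e /andP[eS /eqP exy]].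
  have [eG eU] : e \in eset G /\ ends G e \subset U.
    by move: eS; rewrite inE => /andP[_]; rewrite inE => /andP[].
  have [i ei] := EU eG eU.
  have /EiP[_ /subsetP eVi] := ei.
  have [xi yi] : x \in Vs i /\ y \in Vs i by rewrite !eVi // exy !inE eqxx
    ?orbT.
  have E1 z : z \in Vs i -> (z \in merged k v) = (v \in Vs i).
    move=> zi; rewrite inE; apply/orP/idP=> [[/eqP<- //|]|vi].
      by case/existsP=> i' /and3P[_ vi' zi']; rewrite (Vs_disj zi zi').
    by right; apply/existsP; exists i; rewrite ltn_ord vi zi.
  by rewrite !E1.
rewrite inE => /predU1P[->|/existsP[i /and3P[_ vi wi]]]; first exact: connect0.
have [->|vw] := eqVneq v w; first exact: connect0.
apply: connect1; have /eqP/cards1P[e eE] := Vs_simple vi wi vw.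
have : e \in [set e in Ei i | ends G e == [set v; w]] by rewrite eE inE.
rewrite inE => /andP[ei /eqP exy]; apply/existsP; exists e.
by rewrite exy eqxx andbT inE (EiU ei) (subsetP (EiG i)).
Qed.

Lemma hybrid_sumk : hybrid_sum k =
  \sum_(T in spanning_trees (contract G U) N)
     \prod_(i < k) #|Vs i| ^ (#|Vs i| +
        #|incident (spanning (contract G U) T) (Vs i)|).
Proof.
have notE e i : e \in contract_eset G U -> e \notin Ei i.
  by rewrite inE => /andP[eU _]; apply: contra eU; apply: EiU.
have vsetE : vset (contract G U) = pblock (contract_vset G U) @: D.
  have /and3P[/eqP cov tI n0] := contract_vset_partition G U.
  apply/setP=> c; apply/idP/imsetP=> [cP|[v vD ->]];
    last by rewrite pblock_mem ?cov.
  have /set0Pn[v vc] : c != set0 by apply: contraTneq cP => ->.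
  exists v; last by rewrite (def_pblock tI cP vc).
  by rewrite -cov; apply/bigcupP; exists c.
have treeE (T : {set E}) : T \subset contract_eset G U ->
    tree (spanning (contract G U) T) = sptree G (merged k) T.
  move=> TC; have TG := subset_trans TC (subsetDl _ _).
  rewrite tree_sptree // (sptree_quotient TG vsetE) //.
  by apply: sptree_ker => v w vD wD; rewrite !pblock_merged.
have notU (T : {set E}) e : T \subset eset G -> [forall i : 'I_k,
    if i < k then [disjoint T & Ei i] else Mi i \subset T] -> e \in T ->
    e \in contract_eset G U.
  move=> TG /forallP HT eT; rewrite inE (subsetP TG e eT) andbT; apply/negP.
  rewrite inE => /andP[eG eU]; have [i ei] := EU eG eU.
  by have := HT i; rewrite ltn_ord => /disjointFr/(_ eT); rewrite ei.
apply: eq_big => [T|T /and4P[TG NT HT _]].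
  rewrite inE /hybrid; apply/and4P/and3P=> [[TG NT HT tT]|[TC tT NT]].
    have TC : T \subset contract_eset G U by apply/subsetP=> e; apply: notU HT.
    by rewrite treeE.
  split; rewrite -?treeE //; first exact: subset_trans TC (subsetDl _ _).
  apply/forallP=> i; rewrite ltn_ord; apply/pred0P=> e /=; apply/negbTE/negP.
  by case/andP=> /(subsetP TC)/(notE e i)/negP.
rewrite /hybrid_weight; apply: eq_big => i; first by rewrite ltn_ord.
move=> _; congr (_ ^ (_ + _)); apply: eq_card => e;
  rewrite [LHS]in_setI [RHS]inE /=.
rewrite in_setI andbAC -andbA; case: (boolP (e \in T)) => eT;
  rewrite ?andbF //= andbT.
have eC := notU T e TG HT eT; rewrite eC /=.
have eG := subsetP TG e eT; have eD := subsetP (ends_sub eG).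
apply/idP/imsetP=> [/Mi_end[x xe xi]|[x xe xE]].
  by exists x; rewrite // pblock_merged ?eD // (merged_in (ltn_ord i) xi).
have xi : x \in Vs i by rewrite xE pblock_merged ?eD // inE eqxx.
by have := touch eG xe xi; rewrite (negPf (notE e i eC)).
Qed.

End Assembly.

Import Order.TTheory GRing.Theory Num.Theory.
Local Open Scope ring_scope.

Theorem theorem4p1 (V E : finType) (G : mgraph V E) (k : nat)
    (V0 : {set V}) (Vs : 'I_k -> {set V}) (N : {set E}) :
  let Mi (i : 'I_k) := edges_between G (Vs i) V0 in
  let M := \bigcup_(i < k) Mi i in
  let U := \bigcup_(i < k) Vs i in
  connected G ->
  (1 <= k)%N ->
  partition (V0 |: [set Vs i | i : 'I_k]) (vset G) ->
  injective Vs ->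
  (forall i : 'I_k, Vs i != V0) ->
  (forall i : 'I_k, clique G (Vs i)) ->
  (forall i j : 'I_k, (i < j)%N -> edges_between G (Vs i) (Vs j) = set0) ->
  (forall C : {set V}, C \in components (edge_induced G M) ->
     exists2 c, c \in V0 & star_with_center (induced (edge_induced G M) C) c) ->
  N \subset eset (induced G V0) ->
  (tau G (M :|: N))%:R =
    (\prod_(i < k)
        (#|Vs i|%:R : rat) ^ (#|Vs i|%:Z - 2%:Z - #|Mi i|%:Z)) *
    (\sum_(T in spanning_trees (contract G U) N)
        \prod_(i < k)
          (#|Vs i|%:R : rat) ^+ #|incident (spanning (contract G U) T) (Vs i)|)
  :> rat.
Proof.
move=> Mi M U _ _ V_part Vs_inj Vs_V0 Vs_clique Vs_sep M_stars NV0.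
have n0 i : #|Vs i|%:R != 0 :> rat.
  rewrite pnatr_eq0 -lt0n card_gt0; have /and3P[_ _] := V_part.
  by apply: contraNneq => <-; rewrite !inE imset_f ?orbT.
have := hybrid_sum_prod V_part Vs_inj Vs_V0 Vs_clique Vs_sep M_stars NV0.
rewrite hybrid_sumk // hybrid_sum0 // -/U -/M => /(congr1 (fun n => n%:R : rat)).
rewrite natrM natr_sum natr_prod => sumE.
pose p := \prod_(i < k) (#|Vs i|%:R : rat) ^+ (2 + #|Mi i|).
have p0 : p != 0 by apply/prodf_neq0 => i _; rewrite expf_neq0.
apply: (mulfI p0); rewrite mulrA -big_split /=.
transitivity (\prod_(i < k) (#|Vs i|%:R : rat) ^+ #|Vs i| *
  (\sum_(T in spanning_trees (contract G U) N) \prod_(i < k)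
     (#|Vs i|%:R : rat) ^+ #|incident (spanning (contract G U) T) (Vs i)|)).
  rewrite (_ : p = \prod_(i < k) (#|Vs i| ^ (2 + #|Mi i|))%:R); last first.
    by apply: eq_bigr => i _; rewrite natrX.
  rewrite -sumE mulr_sumr; apply: eq_bigr => T _.
  by rewrite natr_prod -big_split; apply: eq_bigr => i _; rewrite natrX exprD.
congr (_ * _); apply: eq_bigr => i _.
rewrite !exprnP -expfzDr //; congr (_ ^ _); lia.
Qed.
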